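(* Let $n\ge2$, $k\in\{1,\dots,n-1\}$. The rational maps $\Theta_{n-k}^{-1}\circ S\circ\Theta_{n-k}:\mathbb T_k\to\mathbb T_k$ and $\Theta_k^{-1}\circ D\circ\Theta_{n-k}:\mathbb T_k\to\mathbb T_{n-k}$ have subtraction-free components; let $\widehat S$ and $\widehat D$ be their tropicalizations. Then on the set $B^k$ of $k$-rectangles, $\widehat S=\widetilde{\mathrm{rot}}$ and $\widehat D=\widetilde{\mathrm{refl}}$.
   Context: Notation: $[i,j]=\{m\in\mathbb Z:i\le m\le j\}$, $[n]=[1,n]$, $E_{ij}$ matrix units. For $r\in[n-1]$, $\mathcal X_r=\mathrm{Gr}(r,n)\times\mathbb C^\times$; points of $\mathrm{Gr}(r,n)$ are column spans of full-rank $n\times r$ matrices; $P_J(M)$ is the maximal minor on rows $J$; for a finite set $I$ of integers $P_I(M)=P_{I'}(M)$ with $I'$ the residues mod $n$ in $[n]$, and $P_{I'}=0$ if $|I'|\ne r$. $g^r(M,t)$ is the $n\times n$ matrix over $\mathbb C[\lambda]$ with $A_{ij}=c_{ij}\frac{P_{[j-r+1,j-1]\cup\{i\}}(M)}{P_{[j-r,j-1]}(M)}$, $c_{ij}=1$ if $j\le r$, $t$ if $j>r$ and $i\ge j$, $\lambda$ if $j>r$ and $i<j$. $\mathrm{fl}(A)_{ij}=A_{n-j+1,n-i+1}$. $S:\mathcal X_r\to\mathcal X_r$, $S(M,t)=(S_t(M),t)$, with $S_t(M)$ the column span of the first $r$ columns of $\mathrm{fl}(g^r(M,t))|_{\lambda=(-1)^{r-1}t}$.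 $M^\perp$ is the orthogonal complement w.r.t. $\langle v_i,v_j\rangle=(-1)^{i+1}\delta_{ij}$; $T_{w_0}(M)=Q_{w_0}\cdot M$ with $Q_{w_0}$ the antidiagonal permutation matrix; $D:\mathcal X_r\to\mathcal X_{n-r}$, $D(M,t)=S(T_{w_0}(M^\perp),t)$. Parametrization: for $m\in[n-1]$, $R_m=\{(i,j):1\le i\le m,\ i\le j\le i+n-m-1\}$, $\mathbb T_m=(\mathbb C^\times)^{R_m}\times\mathbb C^\times$. With $x_{-i}(c)=cE_{ii}+c^{-1}E_{i+1,i+1}+E_{i+1,i}+\sum_{j\ne i,i+1}E_{jj}$, $t_i(c)=cE_{ii}+\sum_{j\ne i}E_{jj}$, $M_{[i,j]}(c_i,\dots,c_j)=x_{-i}(c_i)\cdots x_{-(j-1)}(c_{j-1})t_j(c_j)$, let $\Phi_m(X_{ij},t)=\prod_{i=m}^{1}M_{[i,i+n-m]}(X_{ii},\dots,X_{i,i+n-m-1},t)$ (decreasing $i$ left to right) and $\Theta_{n-m}:\mathbb T_m\to\mathcal X_{n-m}$, $\Theta_{n-m}(X_{ij},t)=(\text{span of first }n-m\text{ columns of }\Phi_m(X_{ij},t),\,t)$, a birational isomorphism. Tropicalization: for subtraction-free rational functions (ratios of polynomials with nonnegative integer coefficients), replace $+,\times,\div$ by $\min,+,-$ and positive constants by $0$, with $X_{ij}\mapsto B_{ij}$, $t\mapsto L$; componentwise for tuples. Thus $\widehat S:\mathbb Z^{R_k}\times\mathbb Z\to\mathbb Z^{R_k}\times\mathbb Z$ and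 $\widehat D:\mathbb Z^{R_k}\times\mathbb Z\to\mathbb Z^{R_{n-k}}\times\mathbb Z$. $k$-rectangles: $b=(B_{ij},L)\in\mathbb Z^{R_k}\times\mathbb Z$ with array $A_{ij}=B_{ij}$ on $R_k$, $A_{ij}=L$ for $j>i+n-k-1$ ($1\le i\le j\le n$), is a $k$-rectangle if all $A_{ij}\ge0$ and $A_{i,j+1}\ge A_{ij}\ge A_{i+1,j+1}$ for $1\le i\le j\le n-1$; $B^k$ is their set. $\widetilde{\mathrm{rot}}(B_{ij},L)=(L-B_{k-i+1,n-j},\,L)$ for $(i,j)\in R_k$; $\widetilde{\mathrm{refl}}(B_{ij},L)=(L-B_{j-i+1,j},\,L)$ for $(i,j)\in R_{n-k}$. *)

(* Defs.v *)
From HB Require Import structures.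
From mathcomp Require Import all_boot all_order all_algebra.
From mathcomp Require Import fraction.
From mathcomp Require Import complex reals.
From mathcomp Require Import mpoly.

Set Implicit Arguments.
Unset Strict Implicit.
Unset Printing Implicit Defensive.

Import Order.TTheory GRing.Theory Num.Theory.
Local Open Scope ring_scope.

(* Conventions. All indices are 1-based, as in the mathematical text: the row  *)
(* or column numbered i is the ordinal whose value is i - 1.                   *)

Section Grassmannian.

Variables (F : fieldType) (n : nat).

Local Notation V := 'cV[F]_n.

(* A point of Gr(r, n) x F^* is a pair (M, t) with \dim M = r and t != 0.      *)
Definition in_grass (r : nat) (u : {vspace V} * F) : bool :=
  (\dim u.1 == r) && (u.2 != 0).

Definition span_cols (r : nat) (A : 'M[F]_n) : {vspace V} :=
  <<[seq col j A | j : 'I_n <- enum 'I_n & (j < r)%N]>>%VS.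

(* A full-rank n x r matrix with column span M, when \dim M = r. Only ratios   *)
(* of its maximal minors are used, and these do not depend on the basis.       *)
Definition frame (r : nat) (M : {vspace V}) : 'M[F]_(n, r) :=
  \matrix_(i, j) ((vbasis M)`_j : V) i 0.

Definition intervalz (a b : int) : seq int :=
  if a <= b then [seq a + d%:Z | d <- iota 0 `|b - a|.+1] else [::].

Definition residues (I : seq int) : {set 'I_n} :=
  [set x : 'I_n | has (fun i => (i == x.+1%:Z %[mod n])%Z) I].

Definition plucker (r : nat) (M : {vspace V}) (I : seq int) : F :=
  let J := residues I in
  if #|J| == r then
    \det (\matrix_(a < r, b < r) [seq frame r M i b | i <- enum J]`_a)
  else 0.

(* The indeterminate 'X of {poly F} is lambda.                                 *)
Definition gmat (r : nat) (M : {vspace V}) (t : F) : 'M[{poly F}]_n :=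
  \matrix_(a, b)
    let i := a.+1 in let j := b.+1 in
    let c : {poly F} :=
      if (j <= r)%N then 1 else if (j <= i)%N then t%:P else 'X in
    c * (plucker r M (rcons (intervalz (j%:Z - r%:Z + 1) (j%:Z - 1)) i%:Z)
         / plucker r M (intervalz (j%:Z - r%:Z) (j%:Z - 1)))%:P.

Definition fl (K : Type) (A : 'M[K]_n) : 'M[K]_n :=
  \matrix_(i, j) A (rev_ord j) (rev_ord i).

Definition S_space (r : nat) (M : {vspace V}) (t : F) : {vspace V} :=
  span_cols r (map_mx (horner_eval ((-1) ^+ r.-1 * t)) (fl (gmat r M t))).

(* The graph of the rational map S : X_r --> X_r, over the open set where the  *)
(* denominators of g^r do not vanish and the image has dimension r.            *)
Definition S_graph (r : nat) (u v : {vspace V} * F) : Prop :=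
  [/\ in_grass r u,
      forall j, (1 <= j <= n)%N ->
        plucker r u.1 (intervalz (j%:Z - r%:Z) (j%:Z - 1)) != 0,
      v = (S_space r u.1 u.2, u.2)
    & in_grass r v].

(* For 0-based i the sign (-1)^(i + 1) of the form becomes (-1)^i.             *)
Definition altform (u v : V) : F := \sum_(i < n) (-1) ^+ i * u i 0 * v i 0.

Definition perp (M : {vspace V}) : {vspace V} :=
  (\bigcap_(u <- vbasis M) lker (linfun (altform u : V -> F^o)))%VS.

Definition Tw0 (M : {vspace V}) : {vspace V} :=
  (linfun (mulmx (\matrix_(i, j) (i == rev_ord j)%:R : 'M[F]_n) : V -> V)
    @: M)%VS.

(* The graph of the rational map D : X_r --> X_(n - r).                        *)
Definition D_graph (r : nat) (u v : {vspace V} * F) : Prop :=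
  in_grass r u /\ S_graph (n - r) (Tw0 (perp u.1), u.2) v.

Lemma perpP (M : {vspace V}) (v : V) :
  reflect (forall u, u \in M -> altform u v = 0) (v \in perp M).
Proof.
have linr u : linear (altform u : V -> F^o).
  move=> a x y; rewrite /altform scaler_sumr -big_split /=.
  by apply: eq_bigr => i _; rewrite !mxE mulrDr mulrCA.
have kerE u : (v \in lker (linfun (altform u : V -> F^o))) = (altform u v == 0).
  pose h := GRing.isLinear.Build _ _ _ _ (altform u : V -> F^o) (linr u).
  pose f : {linear V -> F^o} := HB.pack (altform u : V -> F^o) h.
  by rewrite memv_ker -[linfun _]/(linfun f) lfunE.
have mem_cap (s : seq V) :
    (v \in \bigcap_(u <- s) lker (linfun (altform u : V -> F^o)))%VS
    = all (fun u => altform u v == 0) s.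
  elim: s => [|u s IHs] /=; first by rewrite big_nil memvf.
  by rewrite big_cons memv_cap kerE IHs.
rewrite /perp mem_cap; apply: (iffP allP) => [h u uM | h u /vbasis_mem uM].
  rewrite (coord_vbasis uM) /altform.
  under eq_bigr => i _ do
    rewrite summxE mulr_sumr mulr_suml.
  rewrite exchange_big big1 //= => j _.
  under eq_bigr => i _ do rewrite mxE mulrCA -mulrA.
  rewrite -mulr_sumr; apply/eqP; rewrite mulf_eq0; apply/orP; right.
  exact/h/mem_nth/(leq_trans (ltn_ord j))/eq_leq/esym/size_tuple.
exact/eqP/h.
Qed.

End Grassmannian.

Section Parametrization.

Variables n m : nat.

Definition in_R (i j : nat) : bool :=
  [&& 1 <= i, i <= m, i <= j & j <= i + (n - m) - 1]%N.

(* Both coordinates of an element of R_m are at most n - 1.                    *)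
Definition Rset : Type := {p : 'I_n * 'I_n | in_R p.1 p.2}.

Definition fst_R (p : Rset) : nat := (val p).1.
Definition snd_R (p : Rset) : nat := (val p).2.

(* T^(R_m) x T: points of the torus, lattice points, tuples of functions.      *)
Definition rpoint (T : Type) : Type := ({ffun Rset -> T} * T)%type.

Definition entry (T : zmodType) (x : rpoint T) (i j : nat) : T :=
  if [pick p : Rset | (fst_R p == i) && (snd_R p == j)] is Some p
  then x.1 p else 0.

(* None is the index of the last coordinate (t or L).                          *)
Definition coord_at (T : Type) (x : rpoint T) (v : option Rset) : T :=
  if v is Some p then x.1 p else x.2.

Definition in_torus (F : fieldType) (x : rpoint F) : Prop :=
  forall v, coord_at x v != 0.

Definition nvars : nat := #|{: option Rset}|.

Definition coords (T : Type) (x : rpoint T) (a : 'I_nvars) : T :=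
  coord_at x (enum_val a).

End Parametrization.

Section Theta.

Variables (F : fieldType) (n : nat).

Definition Emx (i j : nat) : 'M[F]_n :=
  \matrix_(a, b) ((a.+1 == i) && (b.+1 == j))%:R.

Definition xminus (i : nat) (c : F) : 'M[F]_n :=
  c *: Emx i i + c^-1 *: Emx i.+1 i.+1 + Emx i.+1 i
  + \sum_(1 <= j < n.+1 | (j != i) && (j != i.+1)) Emx j j.

Definition tdiag (i : nat) (c : F) : 'M[F]_n :=
  c *: Emx i i + \sum_(1 <= j < n.+1 | j != i) Emx j j.

(* M_[i, j](c_i, ..., c_j)                                                     *)
Definition Mint (i j : nat) (c : nat -> F) : 'M[F]_n :=
  (\prod_(i <= l < j) xminus l (c l)) *m tdiag j (c j).

Definition Phi (m : nat) (x : rpoint n m F) : 'M[F]_n :=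
  \prod_(i <- rev (index_iota 1 m.+1))
    Mint i (i + n - m)
      (fun l => if l == (i + n - m)%N then x.2 else entry x i l).

(* Theta_(n - m) : T_m -> X_(n - m)                                            *)
Definition Theta (m : nat) (x : rpoint n m F) : {vspace 'cV[F]_n} * F :=
  (span_cols (n - m) (Phi x), x.2).

End Theta.

Section RationalMaps.

Variables (F : fieldType) (n k m : nat).

(* Rational functions on T_k.                                                  *)
Definition ratfun : Type := {fraction {mpoly F[nvars n k]}}.

Definition has_value (f : ratfun) (x : rpoint n k F) (y : F) : Prop :=
  exists p q : {mpoly F[nvars n k]},
    [/\ f = (tofrac p / tofrac q : {fraction {mpoly F[nvars n k]}}),
        q.@[coords x] != 0 & y = p.@[coords x] / q.@[coords x]].

(* phi, given by its components, is the rational map T_k --> T_m whose graph   *)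
(* over some dense Zariski-open subset of T_k is contained in G.               *)
Definition rational_map_of
    (phi : rpoint n m ratfun) (G : rpoint n k F -> rpoint n m F -> Prop) : Prop :=
  exists2 h : {mpoly F[nvars n k]}, h != 0 &
    forall x : rpoint n k F, in_torus x -> h.@[coords x] != 0 ->
      exists y : rpoint n m F,
        [/\ in_torus y,
            forall v, has_value (coord_at phi v) x (coord_at y v)
          & G x y].

Definition nonneg_poly (N : nat) (p : {mpoly int[N]}) : Prop :=
  p != 0 /\ forall e, 0 <= p@_e.

(* The tropical value of a nonzero polynomial with nonnegative coefficients:   *)
(* the minimum of e . b over its monomials X^e, of which mlead p is one.       *)
Definition trop_poly (N : nat) (p : {mpoly int[N]}) (b : 'I_N -> int) : int :=
  let val_at (e : 'X_{1..N}) := \sum_(a < N) b a *+ e a in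
  \big[Order.min/val_at (mlead p)]_(e <- msupp p) val_at e.

Definition ratio_of (f : ratfun) (p q : {mpoly int[nvars n k]}) : Prop :=
  f = (tofrac (map_mpoly intr p) / tofrac (map_mpoly intr q)
        : {fraction {mpoly F[nvars n k]}}).

Definition subtraction_free (f : ratfun) : Prop :=
  exists p q, [/\ nonneg_poly p, nonneg_poly q & ratio_of f p q].

Definition is_trop (f : ratfun) (g : rpoint n k int -> int) : Prop :=
  exists p q, [/\ nonneg_poly p, nonneg_poly q, ratio_of f p q
    & forall b, g b = trop_poly p (coords b) - trop_poly q (coords b)].

Definition is_tropicalization
    (phi : rpoint n m ratfun) (Phat : rpoint n k int -> rpoint n m int) : Prop :=
  forall v, is_trop (coord_at phi v) (fun b => coord_at (Phat b) v).

End RationalMaps.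

(* Theta^-1 o S o Theta and Theta^-1 o D o Theta; applying Theta^-1 to a point *)
(* of its image is taking the y in the torus with that image.                  *)
Definition S_conj_graph (F : fieldType) (n k : nat) (x y : rpoint n k F) : Prop :=
  S_graph (n - k) (Theta x) (Theta y).

Definition D_conj_graph (F : fieldType) (n k : nat)
    (x : rpoint n k F) (y : rpoint n (n - k) F) : Prop :=
  D_graph (n - k) (Theta x) (Theta y).

Section Rectangles.

Variables n k : nat.

(* The rows i > k, on which neither B_ij nor L is prescribed, are zero, as for *)
(* a Gelfand-Tsetlin pattern of rectangular shape with k rows.                 *)
Definition rect_array (b : rpoint n k int) (i j : nat) : int :=
  if in_R n k i j then entry b i j
  else if (i + (n - k) - 1 < j)%N then b.2 else 0.

Definition k_rectangle (b : rpoint n k int) : Prop :=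
  (forall i j, (1 <= i)%N -> (i <= j)%N -> (j <= n)%N -> 0 <= rect_array b i j)
  /\ (forall i j, (1 <= i)%N -> (i <= j)%N -> (j <= n - 1)%N ->
        rect_array b i j <= rect_array b i j.+1 /\
        rect_array b i.+1 j.+1 <= rect_array b i j).

Definition rot_tilde (b : rpoint n k int) : rpoint n k int :=
  ([ffun p => b.2 - entry b (k - fst_R p + 1) (n - snd_R p)], b.2).

Definition refl_tilde (b : rpoint n k int) : rpoint n (n - k) int :=
  ([ffun p => b.2 - entry b (snd_R p - fst_R p + 1) (snd_R p)], b.2).

End Rectangles.

(* Main.v *)
(** Write r = n - k. Each factor M_[i,j](c) is lower bidiagonal with ones below the
    diagonal, so Phi(x) is lower triangular of bandwidth k, and in fact Phi(x) is
    g^r(Theta(x)) at lambda = 0: column j of g^r is characterized, up to scalars, as the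
    vector of the subspace that vanishes on the cyclic interval [j-r+1, j-1]. In the last r
    rows of g^r, the only ones used by S, the lambda-entries vanish, so S sends the column
    span of Phi(x) to that of fl(Phi(x)). As fl reverses products and sends x_(-l)(c) to
    x_(-(n-l))(1/c), pushing the diagonal factors t_j(t) back to the right gives
    fl(Phi(x)) = Phi(x') with x'_ij = t / x_(k-i+1,n-j) and the same t. For D, the inverse
    of the sign-twisted flip of x_(-l)(c) is x_(-(n-l))(c); commuting distant factors gives
    T_w0(Theta(x)^perp) = Theta(z) with z_ab = x_(k+a-b,n-b), and applying S yields
    t / x_(j-i+1,j). Since Theta is injective on the torus, both conjugated maps are
    monomial, and their tropicalizations are linear. *)

Require Import Defs.
From HB Require Import structures.
From mathcomp Require Import all_boot all_order all_algebra.
From mathcomp Require Import fraction complex reals mpoly.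
From mathcomp Require Import zify ring.

Set Implicit Arguments.
Unset Strict Implicit.
Unset Printing Implicit Defensive.

Import Order.TTheory GRing.Theory Num.Theory.
Local Open Scope ring_scope.

(** * Rational functions and tropicalization *)

Lemma poly_nonroot (R : numDomainType) (p : {poly R}) :
  p != 0 -> exists c, p.[c] != 0.
Proof.
move=> p0; pose s := [seq i%:R : R | i <- iota 0 (size p)].
have [/allP roots|/allPn[c _ pc]] := boolP (all (root p) s); last by exists c.
have s_uniq : uniq s.
  by rewrite map_inj_uniq ?iota_uniq // => i j /eqP; rewrite eqr_nat => /eqP.
have := max_poly_roots p0 (introT allP roots) s_uniq.
by rewrite size_map size_iota ltnn.
Qed.

Lemma lift_max_widen (N : nat) (i : 'I_N) : lift ord_max i = widen_ord (leqnSn N) i.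
Proof. exact/val_inj/lift_max. Qed.

Lemma meval_muni (R : comNzRingType) (N : nat) (p : {mpoly R[N.+1]})
    (v : 'I_N -> R) (c : R) :
  p.@[fun i => oapp v c (unlift ord_max i)] = (map_poly (meval v) (muni p)).[c].
Proof.
rewrite mevalE muniE rmorph_sum horner_sum; apply: eq_bigr => m _.
rewrite big_ord_recr /= unlift_none map_polyZ map_polyXn hornerZ hornerXn /=.
rewrite mevalZ mevalX mulrA; congr (_ * _ * _); apply: eq_bigr => i _.
by rewrite mnmE -lift_max_widen liftK.
Qed.

Lemma muni_neq0 (R : nzRingType) (N : nat) (p : {mpoly R[N.+1]}) :
  p != 0 -> muni p != 0.
Proof.
move=> p0; pose low (m : 'X_{1..N.+1}) := [multinom m (widen_ord (leqnSn N) i) | i < N].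
have lead_supp := mlead_supp p0.
apply: contraTneq (lead_supp) => muni0; rewrite -mcoeff_eq0; apply/eqP.
have := congr1 (fun q : {poly _} => q`_(mlead p ord_max)@_(low (mlead p))) muni0.
rewrite coef0 mcoeff0 muniE coef_sum raddf_sum /= (bigD1_seq _ lead_supp) //=.
rewrite coefZ coefXn eqxx mulr1 mcoeffZ mcoeffX eqxx mulr1 big1 ?addr0 // => m ne.
rewrite coefZ coefXn; case: eqP => [eq_max|_]; last by rewrite mulr0 mcoeff0.
rewrite mulr1 mcoeffZ mcoeffX -[X in (X == _)%:R]/(low m).
case: eqP => [eq_low|_]; last by rewrite mulr0.
case/eqP: ne; apply/mnmP => i.
have [j ->|->] := unliftP ord_max i; last by [].
by have := congr1 (fun e : 'X_{1..N} => e j) eq_low; rewrite !mnmE -lift_max_widen.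
Qed.

Lemma mpoly_nonroot (R : numDomainType) (N : nat) (p : {mpoly R[N]}) :
  p != 0 -> exists v, p.@[v] != 0.
Proof.
elim: N p => [|N IH] p p0.
  have p_const : p = (p@_0%MM)%:MP.
    apply/mpolyP => m; rewrite mcoeffC (_ : m = 0%MM) ?eqxx ?mulr1 //.
    by apply/mnmP => -[].
  by exists (fun=> 0); move: p0; rewrite p_const mevalC mpolyC_eq0.
have q0 : lead_coef (muni p) != 0 by rewrite lead_coef_eq0 muni_neq0.
have [v qv] := IH _ q0.
have qv0 : map_poly (meval v) (muni p) != 0.
  apply: contraNneq qv => /(congr1 (fun q : {poly R} => q`_(size (muni p)).-1)).
  by rewrite coef_map coef0 => /eqP.
have [c qvc] := poly_nonroot qv0.
by exists (fun i => oapp v c (unlift ord_max i)); rewrite meval_muni.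
Qed.

Lemma map_mpoly_inj (R S : nzRingType) (f : {rmorphism R -> S}) (N : nat) :
  injective f -> injective (@map_mpoly N R S f).
Proof.
move=> f_inj p q eq_pq; apply/mpolyP => m; apply: f_inj.
by rewrite -!mcoeff_map_mpoly eq_pq.
Qed.

Lemma meval_neq0 (R : comNzRingType) (N : nat) (p : {mpoly R[N]}) (u : 'I_N -> R) :
  p.@[u] != 0 -> p != 0.
Proof. by apply: contraNneq => ->; rewrite meval0. Qed.

Lemma tofrac_div_eq (R : idomainType) (p q p' q' : R) : q != 0 -> q' != 0 ->
  (tofrac p / tofrac q = tofrac p' / tofrac q' :> {fraction R}) <-> p * q' = p' * q.
Proof.
move=> q0 q'0; apply: (iff_trans (rwP eqP)).
by rewrite eqr_div ?tofrac_eq0 // -!tofracM tofrac_eq; apply: iff_sym (rwP eqP).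
Qed.

Section Points.

Variables (n k : nat) (T : Type).

Definition rpoint_of (f : option (Rset n k) -> T) : rpoint n k T :=
  ([ffun p => f (Some p)], f None).

Lemma coord_at_rpoint_of f : coord_at (rpoint_of f) =1 f.
Proof. by case=> [p|] //=; rewrite ffunE. Qed.

Lemma coord_at_inj (x y : rpoint n k T) : coord_at x =1 coord_at y -> x = y.
Proof.
case: x y => [f t] [g u] eq_xy; congr (_, _); last exact: (eq_xy None).
by apply/ffunP => p; exact: (eq_xy (Some p)).
Qed.

Lemma coords_rank (x : rpoint n k T) v : coords x (enum_rank v) = coord_at x v.
Proof. by rewrite /coords enum_rankK. Qed.

Lemma coords_surj (u : 'I_(nvars n k) -> T) : exists x : rpoint n k T, coords x =1 u.
Proof.
exists (rpoint_of (u \o enum_rank)) => a.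
by rewrite /coords coord_at_rpoint_of /= enum_valK.
Qed.

End Points.

Section RationalMapUniqueness.

Variables (F : numFieldType) (n k : nat).
Implicit Types (x : rpoint n k F) (f g : ratfun F n k).

Lemma torus_nonroot (h : {mpoly F[nvars n k]}) :
  h != 0 -> exists2 x : rpoint n k F, in_torus x & h.@[coords x] != 0.
Proof.
move=> h0; have X_neq0 : \prod_a 'X_a != 0 :> {mpoly F[nvars n k]}.
  by apply/prodf_neq0 => a _; rewrite -msupp_eq0 msuppX.
have [u] := mpoly_nonroot (mulf_neq0 h0 X_neq0); have [x xu] := coords_surj u.
rewrite -(meval_eq _ xu) mevalM mulf_eq0 negb_or => /andP[hx].
rewrite rmorph_prod /= => /prodf_neq0 Xx; exists x => // v.
by have := Xx (enum_rank v) isT; rewrite mevalXU coords_rank.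
Qed.

Lemma has_value_inj f x y y' : has_value f x y -> has_value f x y' -> y = y'.
Proof.
case=> p [q [-> qx ->]] [p' [q' [fE q'x ->]]].
move/(tofrac_div_eq _ _ (meval_neq0 qx) (meval_neq0 q'x)): fE => pq.
by apply/eqP; rewrite eqr_div // -!mevalM pq.
Qed.

Lemma ratfun_eq_on (h : {mpoly F[nvars n k]}) f g : h != 0 ->
  (forall x, in_torus x -> h.@[coords x] != 0 ->
     exists y, has_value f x y /\ has_value g x y) ->
  f = g.
Proof.
move=> h0 fg; have [x0 x0_torus hx0] := torus_nonroot h0.
have [_ [[p [q [fE qx0 _]]] [p' [q' [gE q'x0 _]]]]] := fg x0 x0_torus hx0.
have q0 := meval_neq0 qx0; have q'0 := meval_neq0 q'x0.
rewrite fE gE; apply/tofrac_div_eq => //; apply/eqP; rewrite -subr_eq0; apply/negPn/negP.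
move=> diff0; have den0 := mulf_neq0 h0 (mulf_neq0 q0 q'0).
have [x x_torus] := torus_nonroot (mulf_neq0 diff0 den0).
rewrite !mevalM !mulf_eq0 !negb_or => /and4P[/eqP + hx qx q'x]; apply.
have [y [fxy gxy]] := fg x x_torus hx.
have yE := has_value_inj fxy (ex_intro _ p (ex_intro _ q (And3 fE qx erefl))).
have yE' := has_value_inj gxy (ex_intro _ p' (ex_intro _ q' (And3 gE q'x erefl))).
by rewrite mevalB !mevalM; apply/eqP; rewrite subr_eq0 -eqr_div // -yE yE'.
Qed.

Lemma rational_map_unique m (G : rpoint n k F -> rpoint n m F -> Prop) phi psi :
  (forall x y y', in_torus x -> in_torus y -> in_torus y' ->
     G x y -> G x y' -> y = y') ->
  rational_map_of phi G -> rational_map_of psi G -> phi = psi.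
Proof.
move=> G_fun [h h0 phiG] [h' h'0 psiG]; apply: coord_at_inj => v.
apply: (ratfun_eq_on (mulf_neq0 h0 h'0)) => x x_torus.
rewrite mevalM mulf_eq0 negb_or => /andP[hx h'x].
have [y [y_torus phiy Gy]] := phiG x x_torus hx.
have [y' [y'_torus psiy' Gy']] := psiG x x_torus h'x.
exists (coord_at y v); split=> //.
by rewrite (G_fun x y y').
Qed.

End RationalMapUniqueness.

Section TropicalPolynomials.

Variables (N : nat) (b : 'I_N -> int).
Implicit Types (p q : {mpoly int[N]}) (e : 'X_{1..N}).

Definition trop_val e : int := \sum_(a < N) b a *+ e a.

Lemma trop_valD e e' : trop_val (e + e')%MM = trop_val e + trop_val e'.
Proof. by rewrite -big_split; apply: eq_bigr => a _; rewrite mnmDE mulrnDr. Qed.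

Lemma trop_poly_le p e : e \in msupp p -> trop_poly p b <= trop_val e.
Proof. by move=> ep; rewrite /trop_poly; apply: ge_bigmin_seq. Qed.

Lemma trop_poly_attained p :
  p != 0 -> exists2 e, e \in msupp p & trop_poly p b = trop_val e.
Proof.
move=> /mlead_supp lead_p; rewrite /trop_poly big_seq.
elim/big_ind: _ => [|x y [e ep ->] [e' e'p ->]|e ep].
- by exists (mlead p).
- by case: leP => _; [exists e | exists e'].
- by exists e.
Qed.

Lemma nonneg_polyM p q : nonneg_poly p -> nonneg_poly q -> nonneg_poly (p * q).
Proof.
move=> [p0 p_ge0] [q0 q_ge0]; split=> [|e]; first exact: mulf_neq0.
by rewrite mcoeffM sumr_ge0 // => -[e1 e2] _; rewrite mulr_ge0.
Qed.

(* No cancellation: a coefficient of p * q is a sum of nonnegative terms. *)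
Lemma msuppM_nonneg p q e e' : nonneg_poly p -> nonneg_poly q ->
  e \in msupp p -> e' \in msupp q -> (e + e')%MM \in msupp (p * q).
Proof.
move=> [_ p_ge0] [_ q_ge0]; rewrite !mcoeff_msupp => pe qe'.
have e_lt : (mdeg e < (mdeg (e + e')%MM).+1)%N by rewrite mdegD ltnS leq_addr.
have e'_lt : (mdeg e' < (mdeg (e + e')%MM).+1)%N by rewrite mdegD ltnS leq_addl.
rewrite mcoeffM (bigD1 (BMultinom e_lt, BMultinom e'_lt)) //= gt_eqF //.
rewrite ltr_pwDl ?mulr_gt0 ?lt_def ?pe ?qe' ?p_ge0 ?q_ge0 //.
by rewrite sumr_ge0 // => -[e1 e2] _; rewrite mulr_ge0.
Qed.

Lemma trop_polyM p q : nonneg_poly p -> nonneg_poly q ->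
  trop_poly (p * q) b = trop_poly p b + trop_poly q b.
Proof.
move=> p_nonneg q_nonneg; have [pq0 _] := nonneg_polyM p_nonneg q_nonneg.
apply/eqP; rewrite eq_le; apply/andP; split.
  have [e ep ->] := trop_poly_attained p_nonneg.1.
  have [e' e'q ->] := trop_poly_attained q_nonneg.1.
  by rewrite -trop_valD trop_poly_le // msuppM_nonneg.
have [e e_pq ->] := trop_poly_attained pq0.
have /allpairsP[[e1 e2] [/= e1p e2q ->]] := msuppM_le e_pq.
by rewrite trop_valD lerD // trop_poly_le.
Qed.

Lemma trop_polyX e : trop_poly 'X_[e] b = trop_val e.
Proof.
have [|e'] := @trop_poly_attained 'X_[e]; first by rewrite -msupp_eq0 msuppX.
by rewrite msuppX inE => /eqP ->.
Qed.

Lemma trop_polyXU a : trop_poly 'X_a b = b a.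
Proof.
rewrite trop_polyX /trop_val (bigD1 a) //= mnm1E eqxx mulr1n big1 ?addr0 // => i ne.
by rewrite mnm1E eq_sym (negPf ne).
Qed.

Lemma trop_poly1 : trop_poly 1 b = 0.
Proof.
by rewrite -mpolyX0 trop_polyX /trop_val big1 // => a _; rewrite mnm0E.
Qed.

Lemma nonneg_polyX e : nonneg_poly ('X_[e] : {mpoly int[N]}).
Proof. by split=> [|e']; rewrite ?mcoeffX ?ler0n // -msupp_eq0 msuppX. Qed.

Lemma nonneg_poly1 : nonneg_poly (1 : {mpoly int[N]}).
Proof. by split=> [|e]; rewrite ?oner_neq0 // mcoeff1 ler0n. Qed.

End TropicalPolynomials.

Lemma map_mpoly_intr_inj (R : numDomainType) (N : nat) :
  injective (@map_mpoly N int R intr).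
Proof. by apply: map_mpoly_inj => i j /eqP; rewrite eqr_int => /eqP. Qed.

Lemma map_mpoly_intr_neq0 (R : numDomainType) (N : nat) (p : {mpoly int[N]}) :
  p != 0 -> map_mpoly intr p != 0 :> {mpoly R[N]}.
Proof.
apply: contraNneq => p_eq0; apply/eqP/(@map_mpoly_intr_inj R).
by rewrite p_eq0 rmorph0.
Qed.

Lemma is_trop_unique (F : numFieldType) (n k : nat) (f : ratfun F n k)
    (g g' : rpoint n k int -> int) :
  is_trop f g -> is_trop f g' -> g =1 g'.
Proof.
case=> p [q [p_ge0 q_ge0 fE gE]] [p' [q' [p'_ge0 q'_ge0 fE' gE']]] b.
rewrite gE gE'; apply/eqP; rewrite subr_eq addrAC eq_sym subr_eq; apply/eqP.
rewrite -!trop_polyM //; congr (trop_poly _ _).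
apply: (@map_mpoly_intr_inj F).
have map_q0 := map_mpoly_intr_neq0 F q_ge0.1.
have map_q'0 := map_mpoly_intr_neq0 F q'_ge0.1.
by rewrite !rmorphM; apply/esym/(tofrac_div_eq _ _ map_q0 map_q'0); rewrite -fE -fE'.
Qed.

Definition mevalz (R : comNzRingType) (N : nat) (u : 'I_N -> R) (p : {mpoly int[N]}) :
    R :=
  (map_mpoly intr p).@[u].

Definition tropicalizes_to (F : fieldType) (n k m : nat)
    (G : rpoint n k F -> rpoint n m F -> Prop) (That : rpoint n k int -> rpoint n m int) :
    Prop :=
  (exists phi : rpoint n m (ratfun F n k), rational_map_of phi G)
  /\ (forall phi : rpoint n m (ratfun F n k), rational_map_of phi G ->
       (forall v, subtraction_free (coord_at phi v))
       /\ (forall Phat, is_tropicalization phi Phat -> Phat =1 That)).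

Section SubtractionFreeMap.

Variables (F : numFieldType) (n k m : nat).
Variables num den : option (Rset n m) -> {mpoly int[nvars n k]}.
Implicit Types (x : rpoint n k F) (b : rpoint n k int).

Definition ratio_map : rpoint n m (ratfun F n k) :=
  rpoint_of (fun v => tofrac (map_mpoly intr (num v)) / tofrac (map_mpoly intr (den v))).

Definition eval_ratio x : rpoint n m F :=
  rpoint_of (fun v => mevalz (coords x) (num v) / mevalz (coords x) (den v)).

Definition trop_ratio b : rpoint n m int :=
  rpoint_of (fun v => trop_poly (num v) (coords b) - trop_poly (den v) (coords b)).

Hypotheses (num_nonneg : forall v, nonneg_poly (num v))
           (den_nonneg : forall v, nonneg_poly (den v)).
Hypotheses (num_neq0 : forall x v, in_torus x -> mevalz (coords x) (num v) != 0)
           (den_neq0 : forall x v, in_torus x -> mevalz (coords x) (den v) != 0).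
Variable G : rpoint n k F -> rpoint n m F -> Prop.
Hypothesis graph_ratio : forall x y,
  in_torus x -> in_torus y -> G x y <-> y = eval_ratio x.

Lemma rational_map_ratio : rational_map_of ratio_map G.
Proof.
exists 1 => [|x x_torus _]; first exact: oner_neq0.
have ratio_torus : in_torus (eval_ratio x).
  by move=> v; rewrite coord_at_rpoint_of mulf_neq0 ?invr_eq0 ?num_neq0 ?den_neq0.
exists (eval_ratio x); split=> //; last exact/graph_ratio.
move=> v; exists (map_mpoly intr (num v)), (map_mpoly intr (den v)).
by rewrite !coord_at_rpoint_of; split; rewrite ?den_neq0.
Qed.

Theorem subtraction_free_tropicalizes : tropicalizes_to G trop_ratio.
Proof.
split; first by exists ratio_map; apply: rational_map_ratio.
move=> phi phi_G; have -> : phi = ratio_map.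
  apply: (rational_map_unique _ phi_G rational_map_ratio) => x y y' x_t y_t y'_t.
  by move=> /(graph_ratio x_t y_t) -> /(graph_ratio x_t y'_t) ->.
have ratioE v : ratio_of (coord_at ratio_map v) (num v) (den v).
  by rewrite /ratio_of coord_at_rpoint_of.
split=> [v|Phat trop_Phat b]; first by exists (num v), (den v).
apply: coord_at_inj => v.
have trop_v : is_trop (coord_at ratio_map v) (fun b' => coord_at (trop_ratio b') v).
  by exists (num v), (den v); split=> // b'; rewrite coord_at_rpoint_of.
exact: is_trop_unique (trop_Phat v) trop_v b.
Qed.

End SubtractionFreeMap.

Section Entries.

Variables (n m : nat).
Hypothesis m_bounds : (1 <= m < n)%N.

Lemma in_R_Rset (p : Rset n m) : in_R n m (fst_R p) (snd_R p).
Proof. by case: p. Qed.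

Lemma in_R_ex i j : in_R n m i j -> exists2 p : Rset n m, fst_R p = i & snd_R p = j.
Proof.
move=> ijR; have i_lt : (i < n)%N by move: ijR; rewrite /in_R; lia.
have j_lt : (j < n)%N by move: ijR; rewrite /in_R; lia.
by exists (exist _ (Ordinal i_lt, Ordinal j_lt) ijR).
Qed.

Lemma pick_Rset (p : Rset n m) :
  [pick q : Rset n m | (fst_R q == fst_R p) && (snd_R q == snd_R p)] = Some p.
Proof.
case: pickP => [q /andP[/eqP fst_qp /eqP snd_qp]|/(_ p)]; last by rewrite !eqxx.
congr Some; apply/val_inj/eqP; rewrite -pair_eqE.
by apply/andP; split; apply/eqP/val_inj.
Qed.

Lemma entry_Rset (T : zmodType) (x : rpoint n m T) p :
  entry x (fst_R p) (snd_R p) = x.1 p.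
Proof. by rewrite /entry pick_Rset. Qed.

Lemma entry_neq0 (F : fieldType) (x : rpoint n m F) i j :
  in_torus x -> in_R n m i j -> entry x i j != 0.
Proof. by move=> x_torus /in_R_ex[p <- <-]; rewrite entry_Rset (x_torus (Some p)). Qed.

Definition entry_poly (i j : nat) : {mpoly int[nvars n m]} :=
  if [pick p : Rset n m | (fst_R p == i) && (snd_R p == j)] is Some p
  then 'X_(enum_rank (Some p)) else 1.

Lemma entry_poly_Rset p : entry_poly (fst_R p) (snd_R p) = 'X_(enum_rank (Some p)).
Proof. by rewrite /entry_poly pick_Rset. Qed.

Lemma nonneg_entry_poly i j : nonneg_poly (entry_poly i j).
Proof.
by rewrite /entry_poly; case: pickP => *; [apply: nonneg_polyX | apply: nonneg_poly1].
Qed.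

Lemma mevalz_entry_poly (F : fieldType) (x : rpoint n m F) i j :
  in_R n m i j -> mevalz (coords x) (entry_poly i j) = entry x i j.
Proof.
case/in_R_ex => p <- <-; rewrite entry_poly_Rset entry_Rset /mevalz map_mpolyX.
by rewrite mevalXU coords_rank.
Qed.

Lemma trop_entry_poly (b : rpoint n m int) i j :
  in_R n m i j -> trop_poly (entry_poly i j) (coords b) = entry b i j.
Proof.
by case/in_R_ex => p <- <-; rewrite entry_poly_Rset entry_Rset trop_polyXU coords_rank.
Qed.

End Entries.

Section ComplementMap.

Variables (n k m : nat) (row col : nat -> nat -> nat).
Hypothesis k_bounds : (1 <= k < n)%N.
Hypothesis in_R_row_col : forall i j, in_R n m i j -> in_R n k (row i j) (col i j).

Definition complement_map (F : fieldType) (x : rpoint n k F) : rpoint n m F :=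
  ([ffun p => x.2 / entry x (row (fst_R p) (snd_R p)) (col (fst_R p) (snd_R p))], x.2).

Definition trop_complement_map (b : rpoint n k int) : rpoint n m int :=
  ([ffun p => b.2 - entry b (row (fst_R p) (snd_R p)) (col (fst_R p) (snd_R p))], b.2).

Lemma entry_complement_map (F : fieldType) (x : rpoint n k F) i j :
  (1 <= m < n)%N -> in_R n m i j ->
  entry (complement_map x) i j = x.2 / entry x (row i j) (col i j).
Proof. by move=> m_bounds /(in_R_ex m_bounds)[p <- <-]; rewrite entry_Rset ffunE. Qed.

Lemma complement_map_torus (F : fieldType) (x : rpoint n k F) :
  in_torus x -> in_torus (complement_map x).
Proof.
move=> x_torus [p|] /=; last exact: (x_torus None).
rewrite ffunE mulf_neq0 ?invr_eq0 ?(x_torus None) // entry_neq0 //.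
exact/in_R_row_col/in_R_Rset.
Qed.

Definition complement_num (v : option (Rset n m)) : {mpoly int[nvars n k]} :=
  'X_(enum_rank None).

Definition complement_den (v : option (Rset n m)) : {mpoly int[nvars n k]} :=
  if v is Some p then entry_poly n k (row (fst_R p) (snd_R p)) (col (fst_R p) (snd_R p))
  else 1.

Lemma complement_mapE (F : fieldType) (x : rpoint n k F) v :
  coord_at (complement_map x) v
  = mevalz (coords x) (complement_num v) / mevalz (coords x) (complement_den v).
Proof.
rewrite /mevalz map_mpolyX mevalXU coords_rank; case: v => [p|] /=.
  by rewrite ffunE -/(mevalz _ _) mevalz_entry_poly //; apply/in_R_row_col/in_R_Rset.
by rewrite rmorph1 meval1 divr1.
Qed.

Lemma trop_complement_mapE b v :
  coord_at (trop_complement_map b) v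
  = trop_poly (complement_num v) (coords b) - trop_poly (complement_den v) (coords b).
Proof.
rewrite trop_polyXU coords_rank; case: v => [p|] /=; last by rewrite trop_poly1 subr0.
by rewrite ffunE trop_entry_poly //; apply/in_R_row_col/in_R_Rset.
Qed.

Theorem complement_map_tropicalizes (F : numFieldType)
    (G : rpoint n k F -> rpoint n m F -> Prop) :
  (forall x y, in_torus x -> in_torus y -> G x y <-> y = complement_map x) ->
  tropicalizes_to G trop_complement_map.
Proof.
move=> graph_G; have nonneg_num v : nonneg_poly (complement_num v) by apply: nonneg_polyX.
have nonneg_den v : nonneg_poly (complement_den v).
  by case: v => [p|]; [apply: nonneg_entry_poly | apply: nonneg_poly1].
have ratio_neq0 (x : rpoint n k F) v : in_torus x ->
    mevalz (coords x) (complement_num v) != 0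
    /\ mevalz (coords x) (complement_den v) != 0.
  move=> /complement_map_torus/(_ v); rewrite complement_mapE mulf_eq0 invr_eq0 negb_or.
  by move/andP.
have [|phi_ex phi_trop] := subtraction_free_tropicalizes nonneg_num nonneg_den
    (fun x v x_torus => (ratio_neq0 x v x_torus).1)
    (fun x v x_torus => (ratio_neq0 x v x_torus).2) (G := G).
  move=> x y x_torus y_torus; rewrite graph_G //.
  suff -> : complement_map x = eval_ratio complement_num complement_den x by [].
  by apply: coord_at_inj => v; rewrite complement_mapE coord_at_rpoint_of.
split=> // phi /phi_trop[sf trop]; split=> // Phat /trop PhatE b.
by apply: coord_at_inj => v; rewrite PhatE coord_at_rpoint_of trop_complement_mapE.
Qed.

End ComplementMap.

(** * The generators *)

(* The factor M_[i, i + d](c) acting on a column, with 0-based coordinates: it is lower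
   bidiagonal, with diagonal c_i, c_(i+1) / c_i, .., c_(i+d) / c_(i+d-1) on the rows it
   affects and ones below it. *)
Definition Mint_act (F : fieldType) (i d : nat) (c u : nat -> F) (a : nat) : F :=
  if a.+1 == i then c i * u a
  else if (i <= a < i + d)%N then u a.-1 + c a.+1 / c a * u a
  else u a.

Section Generators.

Variables (F : fieldType) (n : nat).
Implicit Types (c : F) (u : nat -> F) (A B : 'M[F]_n).

Definition natcol u : 'cV[F]_n := \col_i u i.

Lemma eq_natcol u u' : (forall a, (a < n)%N -> u a = u' a) -> natcol u = natcol u'.
Proof. by move=> eq_u; apply/matrixP => a b; rewrite !mxE eq_u. Qed.

Lemma natcol_surj (v : 'cV[F]_n) : {u | v = natcol u & forall a, (n <= a)%N -> u a = 0}.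
Proof.
exists (fun a => oapp (v^~ 0) 0 (insub a)) => [|a n_le_a].
  by apply/matrixP => a b; rewrite ord1 mxE valK.
by rewrite insubN // -leqNgt.
Qed.

Lemma eq_mulmx_natcol A B : (forall u, A *m natcol u = B *m natcol u) -> A = B.
Proof.
move=> eq_AB; apply/matrixP => i j; have [u uE _] := natcol_surj (delta_mx j 0).
by have := congr1 (fun v : 'cV[F]_n => v i 0) (eq_AB u); rewrite -uE -!colE !mxE.
Qed.

Lemma Emx_natcol i j u : (0 < j <= n)%N ->
  Emx F n i j *m natcol u = natcol (fun a => (a.+1 == i)%:R * u j.-1).
Proof.
case: j => // j j_lt; apply/matrixP => a b; rewrite !mxE (bigD1 (Ordinal j_lt)) //=.
rewrite !mxE eqxx andbT big1 ?addr0 // => l; rewrite -val_eqE /= => ne.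
by rewrite !mxE eqSS (negPf ne) andbF mul0r.
Qed.

Lemma sum_Emx (P : pred nat) :
  \sum_(1 <= j < n.+1 | P j) Emx F n j j = diag_mx (\row_a (P a.+1)%:R).
Proof.
apply/matrixP => a b; rewrite summxE big_mkcond.
rewrite (bigD1_seq a.+1) ?iota_uniq ?mem_index_iota ?ltnS ?ltn_ord //=.
rewrite big1 => [|j /negPf ne].
  rewrite addr0 !mxE eqxx eqSS -val_eqE eq_sym.
  by case: eqP => _; case: ifP; rewrite ?mulr1n ?mulr0n.
by rewrite !mxE [_ == j]eq_sym ne if_same.
Qed.

Lemma xminusE l c :
  xminus n l c =
    diag_mx (\row_a if a.+1 == l then c else if a == l :> nat then c^-1 else 1)
    + Emx F n l.+1 l.
Proof.
rewrite /xminus sum_Emx addrAC; congr (_ + _); apply/matrixP => a b.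
rewrite !mxE !eqSS -val_eqE; have [->|ne] := eqVneq (a : nat) b.
  rewrite !andbb !mulr1n; case: (eqVneq b.+1 l) => [<-|_] /=.
    by rewrite (ltn_eqF (ltnSn b)) mulr1 mulr0 !addr0.
  by case: eqP => _; rewrite ?mulr1 ?mulr0 ?addr0 ?add0r.
rewrite !mulr0n addr0 (_ : _ && _ = false) ?mulr0 ?add0r; last by lia.
by rewrite (_ : _ && _ = false) ?mulr0 //; lia.
Qed.

Lemma tdiagE i c : tdiag n i c = diag_mx (\row_a if a.+1 == i then c else 1).
Proof.
rewrite /tdiag sum_Emx; apply/matrixP => a b.
rewrite !mxE -val_eqE; have [->|ne] := eqVneq (a : nat) b.
  by rewrite andbb !mulr1n; case: eqP => _; rewrite ?mulr1 ?mulr0 ?addr0 ?add0r.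
by rewrite !mulr0n addr0 (_ : _ && _ = false) ?mulr0 //; lia.
Qed.

Lemma xminus_natcol l c u : (1 <= l < n)%N ->
  xminus n l c *m natcol u =
  natcol (fun a => if a.+1 == l then c * u a
                   else if a == l then u a.-1 + c^-1 * u a else u a).
Proof.
move=> l_bounds; rewrite xminusE mulmxDl Emx_natcol; last by lia.
apply/matrixP => a b; rewrite mul_diag_mx !mxE eqSS.
case: eqVneq => [<-|_]; first by rewrite (ltn_eqF (ltnSn a)) mul0r addr0.
by case: eqVneq => [->|_]; rewrite ?mul1r ?mul0r ?addr0 // addrC.
Qed.

Lemma tdiag_natcol i c u :
  tdiag n i c *m natcol u = natcol (fun a => if a.+1 == i then c * u a else u a).
Proof.
rewrite tdiagE; apply/matrixP => a b; rewrite mul_diag_mx !mxE.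
by case: ifP; rewrite ?mul1r.
Qed.

Lemma Mint_natcol i d (c : nat -> F) u : (0 < i)%N -> (i + d <= n)%N ->
  Mint n i (i + d) c *m natcol u = natcol (Mint_act i d c u).
Proof.
elim: d i u => [|d IH] i u i_gt0 id_le.
  rewrite /Mint addn0 big_geq // mul1mx tdiag_natcol.
  by apply: eq_natcol => a _; rewrite /Mint_act; case: ifP => // _; rewrite ifF //; lia.
have := IH i.+1 u isT; rewrite addSnnS => /(_ id_le).
rewrite /Mint [in X in _ -> X]big_ltn; last by lia.
rewrite -mulmxE -!mulmxA => ->; rewrite xminus_natcol; last by lia.
apply: eq_natcol => a _; rewrite /Mint_act.
case: (ltngtP a.+1 i) => [lt_ai|gt_ai|eq_ai].
- by rewrite !ifF //; lia.
- have [<-|ne] := eqVneq a i.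
    rewrite !eqxx [X in X + _]ifF ?[X in X + _]ifF ?ifT; try lia.
    by rewrite [c a.+1 / _]mulrC mulrA.
  by rewrite eqSS (negPf ne); congr (if _ then _ else _); lia.
- by rewrite -eq_ai !ifF //; lia.
Qed.

Lemma tdiag_xminus i c d : (1 <= i < n)%N -> c != 0 ->
  tdiag n i c * xminus n i d = xminus n i (c * d) * tdiag n i.+1 c.
Proof.
move=> i_bounds c0; apply: eq_mulmx_natcol => u; rewrite -!mulmxE -!mulmxA.
rewrite xminus_natcol // !tdiag_natcol xminus_natcol //; apply: eq_natcol => a _.
rewrite eqSS; case: (eqVneq a.+1 i) => [<-|_].
  by rewrite [a == _]ltn_eqF // mulrA.
case: eqVneq => [eq_ai|//]; rewrite ifF; last by lia.
by congr (_ + _); rewrite invfM mulrCA mulrA mulVKf.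
Qed.

Lemma xminus_comm l c l' d : (1 <= l)%N -> (l.+1 < l')%N -> (l' < n)%N ->
  xminus n l c * xminus n l' d = xminus n l' d * xminus n l c.
Proof.
move=> l_gt0 lt_ll' l'_lt; apply: eq_mulmx_natcol => u; rewrite -!mulmxE -!mulmxA.
rewrite !xminus_natcol; try lia.
apply: eq_natcol => a _; case: (eqVneq a.+1 l) => [eq_al|_].
  by rewrite !ifF //; lia.
case: (eqVneq a l) => [eq_al|_]; first by rewrite !ifF //; lia.
case: ifP => // _; case: (eqVneq a l') => // eq_al'.
by rewrite !ifF //; lia.
Qed.

Lemma tdiag_xminus_comm i c l d : (1 <= l < n)%N -> (i < l)%N || (l.+1 < i)%N ->
  tdiag n i c * xminus n l d = xminus n l d * tdiag n i c.
Proof.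
move=> l_bounds il; apply: eq_mulmx_natcol => u; rewrite -!mulmxE -!mulmxA.
rewrite tdiag_natcol !xminus_natcol // tdiag_natcol; apply: eq_natcol => a _.
case: (eqVneq a.+1 l) => [eq_al|_]; first by rewrite !ifF //; lia.
by case: (eqVneq a l) => // eq_al; rewrite !ifF //; lia.
Qed.

End Generators.

(** * The product Phi *)

Lemma rev_index_iotaS m : rev (index_iota 1 m.+2) = m.+1 :: rev (index_iota 1 m.+1).
Proof.
rewrite /index_iota !subSS !subn0 -[X in iota 1 X]addn1 iotaD cats1 add1n.
by rewrite rev_rcons.
Qed.

Lemma backward_recursion (R : pzRingType) (q y : nat -> R) (m d : nat) :
  exists2 u : nat -> R, u (m + d)%N = 0 &
    forall a, (m < a <= m + d)%N -> u a.-1 + q a * u a = y a.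
Proof.
elim: d m => [|d IH] m; first by exists (fun=> 0) => // a; lia.
have [u u0 uE] := IH m.+1.
exists (fun a => if a == m then y m.+1 - q m.+1 * u m.+1 else u a) => [|a a_bounds].
  by rewrite ifF ?addnS //; lia.
have -> : (a == m) = false by lia.
case: eqP => [eq_am|ne_am]; last by apply: uE; lia.
by have -> : a = m.+1 by [lia]; rewrite subrK.
Qed.

Definition vanishes_on (R : nmodType) (s e : nat) (u : nat -> R) : Prop :=
  forall a, (s <= a < e)%N -> u a = 0.

Definition supported_below (R : nmodType) (c : nat) (u : nat -> R) : Prop :=
  forall a, (c <= a)%N -> u a = 0.

Definition dirac (R : nzSemiRingType) (c a : nat) : R := (a == c)%:R.

Lemma dirac_diag (R : nzSemiRingType) c : dirac R c c = 1.
Proof. by rewrite /dirac eqxx. Qed.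

Lemma dirac_vanishes (R : nzSemiRingType) c : vanishes_on 0 c (dirac R c).
Proof. by move=> a lt_ac; rewrite /dirac ltn_eqF. Qed.

Lemma dirac_supported (R : nzSemiRingType) c : supported_below c.+1 (dirac R c).
Proof. by move=> a lt_ca; rewrite /dirac gtn_eqF. Qed.

Section PhiAction.

Variables (F : fieldType) (r : nat) (E : nat -> nat -> F).
Implicit Types (m s c a : nat) (w y : nat -> F).

Fixpoint Phi_act m w : nat -> F :=
  if m is m'.+1 then Mint_act m r (E m) (Phi_act m' w) else w.

Lemma prod_Mint_natcol n m w : (m + r <= n)%N ->
  \prod_(i <- rev (index_iota 1 m.+1)) Mint n i (i + r) (E i) *m natcol n w
  = natcol n (Phi_act m w).
Proof.
elim: m => [|m IH] mr_le; first by rewrite /index_iota big_nil mul1mx.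
by rewrite rev_index_iotaS big_cons -mulmxE -mulmxA IH ?Mint_natcol //; lia.
Qed.

Lemma Phi_act_lt m w a : (a < m)%N -> Phi_act m.+1 w a = Phi_act m w a.
Proof. by move=> lt_am; rewrite /= /Mint_act !ifF //; lia. Qed.

Lemma Phi_act_diag m w : Phi_act m.+1 w m = E m.+1 m.+1 * Phi_act m w m.
Proof. by rewrite /= /Mint_act eqxx. Qed.

Lemma Phi_act_mid m w a : (m < a <= m + r)%N ->
  Phi_act m.+1 w a = Phi_act m w a.-1 + E m.+1 a.+1 / E m.+1 a * Phi_act m w a.
Proof. by move=> a_bounds; rewrite /= /Mint_act ifF ?ifT //; lia. Qed.

Lemma Phi_act_gt m w a : (m + r < a)%N -> Phi_act m.+1 w a = Phi_act m w a.
Proof. by move=> lt_mra; rewrite /= /Mint_act !ifF //; lia. Qed.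

Lemma Phi_act_id m w a : (m + r <= a)%N -> Phi_act m w a = w a.
Proof. by elim: m => // m IH le_a; rewrite Phi_act_gt ?IH //; lia. Qed.

Lemma Phi_act_tri m w s : vanishes_on 0 s w -> vanishes_on 0 s (Phi_act m w).
Proof.
move=> w0; elim: m => [|m IH] a lt_as; first exact: w0.
have [lt_am|gt_am|eq_am] := ltngtP a m.
- by rewrite Phi_act_lt ?IH.
- have [le_a|gt_a] := leqP a (m + r); last by rewrite Phi_act_gt ?IH.
  by rewrite Phi_act_mid ?gt_am // !IH ?mulr0 ?addr0 //; lia.
- by rewrite eq_am Phi_act_diag IH ?mulr0 // -eq_am.
Qed.

Lemma Phi_act_band m w c :
  supported_below c w -> supported_below (m + c) (Phi_act m w).
Proof.
move=> w0; elim: m => [|m IH] a le_a; first exact: w0.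
have [le_ar|gt_ar] := leqP a (m + r); last by rewrite Phi_act_gt ?IH //; lia.
by rewrite Phi_act_mid ?le_ar ?IH ?mulr0 ?addr0 //; lia.
Qed.

Lemma Phi_act_edge m w c : (c < r)%N -> supported_below c.+1 w ->
  Phi_act m w (m + c) = w c.
Proof.
move=> lt_cr w0; elim: m => // m IH; rewrite Phi_act_mid; last by lia.
by rewrite addSn /= IH [X in _ * X](Phi_act_band (c := c.+1)) ?mulr0 ?addr0 //; lia.
Qed.

Lemma Phi_act_mid_eq0 m w c : supported_below r w ->
  vanishes_on (m.+1 + c) (m.+1 + r) (Phi_act m.+1 w) ->
  supported_below (m + c) (Phi_act m w).
Proof.
move=> w0 act0 a le_a; have [/(Phi_act_band (m := m) w0) //|lt_a] := leqP (m + r) a.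
have [d def_d] := ubnP (m + r - a); elim: d a le_a lt_a def_d => // d IH a le_a lt_a a_d.
have := act0 a.+1; rewrite Phi_act_mid; last by lia.
suff -> : Phi_act m w a.+1 = 0 by rewrite mulr0 addr0; apply; lia.
have [/(Phi_act_band (m := m) w0) //|lt_aS] := leqP (m + r) a.+1.
by apply: IH; lia.
Qed.

Lemma Phi_act_high_eq0 m w c : supported_below r w ->
  vanishes_on (m + c) (m + r) (Phi_act m w) -> supported_below c w.
Proof.
move=> w0; elim: m => [|m IH] act0.
  by move=> a le_ca; have [/w0//|lt_ar] := leqP r a; apply: act0; lia.
by apply: IH => a /andP[le_a _]; apply: (Phi_act_mid_eq0 w0 act0).
Qed.

Lemma Phi_act_solve m y : exists2 w, supported_below r w &
  forall a, (m <= a < m + r)%N -> Phi_act m w a = y a.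
Proof.
elim: m y => [|m IH] y.
  exists (fun a => if (a < r)%N then y a else 0) => [a|a /=].
    by rewrite ltnNge => ->.
  by rewrite add0n => ->.
have [y' y'0 y'E] := backward_recursion (fun a => E m.+1 a.+1 / E m.+1 a) y m r.
have [w w0 wE] := IH y'; exists w => // a a_bounds.
have wE' a' : (m <= a' <= m + r)%N -> Phi_act m w a' = y' a'.
  move=> a'_bounds; have [lt_a'|le_a'] := ltnP a' (m + r); first by apply: wE; lia.
  have -> : a' = (m + r)%N by lia.
  by rewrite Phi_act_id // y'0 w0 // leq_addl.
by rewrite Phi_act_mid ?wE' ?y'E //; lia.
Qed.

Variable k : nat.
Hypothesis E_neq0 : forall m l, (1 <= m <= k)%N -> (m <= l <= m + r)%N -> E m l != 0.

Lemma Phi_act_eq0_step m w s e : (m < k)%N -> (s <= m)%N ->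
  vanishes_on s e (Phi_act m.+1 w) -> vanishes_on s e (Phi_act m w).
Proof.
move=> lt_mk le_sm act0; elim/ltn_ind => a IH a_bounds; have := act0 a a_bounds.
have [lt_am|gt_am|eq_am] := ltngtP a m; first by rewrite Phi_act_lt.
  have [le_a|gt_a] := leqP a (m + r); last by rewrite Phi_act_gt.
  rewrite Phi_act_mid ?gt_am // IH ?add0r; try lia.
  move/eqP; rewrite !mulf_eq0 invr_eq0 !(negPf (E_neq0 _ _)) /=; try lia.
  by move/eqP.
move/eqP; rewrite eq_am Phi_act_diag mulf_eq0 (negPf (E_neq0 _ _)) /=; try lia.
by move/eqP.
Qed.

Lemma Phi_act_low_eq0 m w c : (m <= k)%N ->
  vanishes_on 0 c (Phi_act m w) -> vanishes_on 0 c w.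
Proof.
elim: m => // m IH lt_mk act0; apply: (IH (ltnW lt_mk)).
exact: Phi_act_eq0_step act0.
Qed.

Lemma Phi_act_window_eq0 m w s : (m <= k)%N -> (s <= m)%N -> supported_below r w ->
  vanishes_on s (s + r) (Phi_act m w) -> supported_below 0 w.
Proof.
move=> + + w0; elim: m s => [|m IH] s le_mk le_sm act0.
  by apply: (Phi_act_high_eq0 (m := 0) w0) => a a_bounds; apply: act0; lia.
have [le_sm'|gt_sm] := leqP s m.
  exact: (IH s (ltnW le_mk) le_sm' (Phi_act_eq0_step le_mk le_sm' act0)).
apply: (IH m (ltnW le_mk) (leqnn m)) => a /andP[le_ma _].
apply: (Phi_act_mid_eq0 (c := 0) w0) => [b b_bounds|]; last by rewrite addn0.
by apply: act0; lia.
Qed.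

Variable t : F.
Hypothesis r_gt0 : (0 < r)%N.
Hypothesis E_last : forall m, (1 <= m <= k)%N -> E m (m + r) = t.

(* Column s + r of Phi, corrected at the entry s only, is a combination of the
   first r columns. *)
Lemma Phi_act_twist_base s : (s < k)%N ->
  exists w, [/\ supported_below r w,
    forall a, (s < a)%N -> Phi_act s.+1 w a = Phi_act s.+1 (dirac F (s + r)) a
    & Phi_act s.+1 w s = (-1) ^+ r.-1 * t].
Proof.
move=> lt_sk; set delta := dirac F (s + r).
have [w w0 w_delta] := Phi_act_solve s.+1 (Phi_act s.+1 delta).
have En0 a : (s < a <= s.+1 + r)%N -> E s.+1 a != 0.
  by move=> a_bounds; apply: E_neq0; lia.
have delta_r : Phi_act s delta (s + r) = 1 by rewrite Phi_act_id // /delta dirac_diag.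
have w_r : Phi_act s w (s + r) = 0 by rewrite Phi_act_id ?w0 ?leq_addl.
have diff d : (d <= r)%N -> Phi_act s w (s + (r - d)) - Phi_act s delta (s + (r - d))
    = - ((-1) ^+ d * (t / E s.+1 (s + (r - d)).+1)).
  elim: d => [|d IH] le_dr.
    rewrite subn0 delta_r w_r -addSn E_last ?mul1r ?divff ?sub0r //.
    by rewrite -(E_last (m := s.+1)) ?En0 //; lia.
  set a := (s + (r - d))%N in IH; have prev_a : (s + (r - d.+1))%N = a.-1 by lia.
  have := w_delta a; rewrite !Phi_act_mid; try lia.
  rewrite prev_a (_ : a.-1.+1 = a); last by lia.
  move=> /(_ ltac:(lia)) eq_a.
  have : Phi_act s w a.-1 - Phi_act s delta a.-1
      = - (E s.+1 a.+1 / E s.+1 a * (Phi_act s w a - Phi_act s delta a)).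
    by apply: (addIr (E s.+1 a.+1 / E s.+1 a * Phi_act s w a)); rewrite addrAC eq_a; ring.
  move=> ->; rewrite (IH (ltnW le_dr)).
  by rewrite exprS; field; rewrite !En0 //; lia.
exists w; split=> // [a lt_sa|].
  have [lt_a|ge_a] := ltnP a (s.+1 + r); first by rewrite w_delta ?lt_sa.
  by rewrite !Phi_act_id ?w0 /delta ?dirac_supported //; lia.
have := diff r (leqnn r); rewrite subnn addn0.
rewrite [X in _ - X](Phi_act_tri _ (@dirac_vanishes F _)); last by lia.
rewrite subr0 Phi_act_diag => ->; rewrite -{1}(prednK r_gt0) exprS mulN1r mulNr opprK.
by rewrite mulrCA [E _ _ * _]mulrC divfK ?En0 //; lia.
Qed.

Lemma Phi_act_twist m s : (m <= k)%N -> (s < m)%N ->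
  exists w, [/\ supported_below r w,
    forall a, (s < a)%N -> Phi_act m w a = Phi_act m (dirac F (s + r)) a
    & Phi_act m w s = (-1) ^+ r.-1 * t].
Proof.
elim: m => // m IH lt_mk; rewrite ltnS leq_eqVlt => /predU1P[->|lt_sm].
  exact: Phi_act_twist_base.
have [w [w0 w_delta w_s]] := IH (ltnW lt_mk) lt_sm; exists w.
split=> // [a lt_sa|]; last by rewrite Phi_act_lt.
have [lt_am|gt_am|->] := ltngtP a m; last by rewrite !Phi_act_diag w_delta.
  by rewrite !Phi_act_lt ?w_delta.
have [le_a|gt_a] := leqP a (m + r); last by rewrite !Phi_act_gt ?w_delta.
by rewrite !Phi_act_mid ?gt_am // !w_delta //; lia.
Qed.

End PhiAction.

Section PhiActionInjective.

Variables (F : fieldType) (r k N : nat) (E E' : nat -> nat -> F).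
Hypotheses (r_gt0 : (0 < r)%N) (kr_le : (k + r <= N)%N).
Hypothesis E_neq0 : forall m l, (1 <= m <= k)%N -> (m <= l <= m + r)%N -> E m l != 0.

Lemma Phi_act_inj_step m : (m < k)%N ->
  (forall w a, (a < N)%N -> Phi_act r E m.+1 w a = Phi_act r E' m.+1 w a) ->
  forall a, (a < N)%N ->
    (forall w, Phi_act r E m w a = Phi_act r E' m w a)
    /\ ((m <= a < m + r)%N -> E m.+1 a.+1 = E' m.+1 a.+1).
Proof.
move=> lt_mk eq_act; elim/ltn_ind => a IH lt_aN.
have En0 l : (m < l <= m.+1 + r)%N -> E m.+1 l != 0.
  by move=> l_bounds; apply: E_neq0; lia.
have edge D : (m <= a < m + r)%N -> Phi_act r D m (dirac F (a - m)) a = 1.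
  move=> a_bounds; rewrite -{2}(subnKC (_ : m <= a)%N); last by lia.
  by rewrite Phi_act_edge ?dirac_diag //; [lia | apply: dirac_supported].
have [lt_am|gt_am|eq_am] := ltngtP a m.
- by split=> [w|]; [have := eq_act w a lt_aN; rewrite !Phi_act_lt | lia].
- have [ge_a|lt_a] := leqP (m + r) a; first by split=> [w|]; [rewrite !Phi_act_id | lia].
  have [eq_prev eq_Ea] := IH a.-1 ltac:(lia) ltac:(lia).
  have {}eq_Ea : E m.+1 a = E' m.+1 a by rewrite prednK in eq_Ea; [apply: eq_Ea|]; lia.
  have eq_a w : E m.+1 a.+1 / E m.+1 a * Phi_act r E m w a
                = E' m.+1 a.+1 / E m.+1 a * Phi_act r E' m w a.
    have := eq_act w a lt_aN; rewrite !Phi_act_mid ?gt_am ?(ltnW lt_a) // eq_prev eq_Ea.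
    exact: addrI.
  have eq_Ea1 : E m.+1 a.+1 = E' m.+1 a.+1.
    have := eq_a (dirac F (a - m)); rewrite !edge ?lt_a ?(ltnW gt_am) // !mulr1.
    by apply: mulIf; rewrite invr_eq0 En0 //; lia.
  split=> // w; apply: (mulfI (_ : E m.+1 a.+1 / E m.+1 a != 0)); last first.
    by rewrite eq_a eq_Ea1.
  by rewrite mulf_neq0 ?invr_eq0 ?En0 //; lia.
have eq_a w : E m.+1 a.+1 * Phi_act r E m w a = E' m.+1 a.+1 * Phi_act r E' m w a.
  by have := eq_act w a lt_aN; rewrite eq_am !Phi_act_diag.
have eq_Ea1 : E m.+1 a.+1 = E' m.+1 a.+1.
  by have := eq_a (dirac F (a - m)); rewrite !edge ?mulr1 //; lia.
split=> // w; apply: (mulfI (_ : E m.+1 a.+1 != 0)); last by rewrite eq_a eq_Ea1.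
by rewrite En0 //; lia.
Qed.

Lemma Phi_act_inj m : (m <= k)%N ->
  (forall w a, (a < N)%N -> Phi_act r E m w a = Phi_act r E' m w a) ->
  forall i l, (1 <= i <= m)%N -> (i <= l < i + r)%N -> E i l = E' i l.
Proof.
elim: m => [|m IH] le_mk eq_act i l i_bounds l_bounds; first by lia.
have eq_step := Phi_act_inj_step le_mk eq_act.
have [le_im|gt_im] := leqP i m.
  by apply: IH => [|w a lt_aN||]; [lia|apply: (eq_step a lt_aN).1|lia|lia].
have -> : i = m.+1 by lia.
have -> : l = l.-1.+1 by lia.
by apply: (eq_step _ _).2; lia.
Qed.

End PhiActionInjective.

(** * Maximal minors *)

Section RowsDet.

Variables (R : comNzRingType) (n r : nat) (A : 'M[R]_(n, r)).
Implicit Types (s : seq 'I_n) (p : 'I_n).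

Definition rows_det s : R := \det (\matrix_(a < r, b < r) [seq A i b | i <- s]`_a).

(* The vector of signed minors of the rows s against which the expansion of a determinant
   along an additional row is taken. *)
Definition minors_col s : 'cV[R]_r :=
  \col_j ((-1) ^+ j
          * \det (\matrix_(a < r.-1, b < r.-1) [seq A i (lift j b) | i <- s]`_a)).

Lemma rows_det_expand s1 s2 p : (size (s1 ++ s2)).+1 = r ->
  rows_det (s1 ++ p :: s2) = (-1) ^+ size s1 * (A *m minors_col (s1 ++ s2)) p 0.
Proof.
move=> size_s; have row_p : (size s1 < r)%N by rewrite -size_s size_cat ltnS leq_addr.
rewrite /rows_det (expand_det_row _ (Ordinal row_p)) mxE mulr_sumr.
apply: eq_bigr => j _; rewrite !mxE map_cat nth_cat size_map ltnn subnn /=.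
rewrite /cofactor exprD -mulrA [RHS]mulrCA; congr (_ * (_ * (_ * \det _))).
apply/matrixP => a b; rewrite !mxE !map_cat !nth_cat !size_map /= /bump.
case: (leqP (size s1) a) => [le_a|gt_a]; last by rewrite add0n gt_a.
by rewrite add1n ltnNge ltnW //= subSn.
Qed.

Lemma rows_det_cons s p : (size s).+1 = r ->
  rows_det (p :: s) = (A *m minors_col s) p 0.
Proof. by move=> size_s; rewrite (rows_det_expand (s1 := [::])) // mul1r. Qed.

Lemma minors_col_orth s x : (size s).+1 = r -> x \in s -> (A *m minors_col s) x 0 = 0.
Proof.
move=> size_s xs; rewrite -rows_det_cons //.
have row0 : (0 < r)%N by rewrite -size_s.
have row_x : ((index x s).+1 < r)%N by rewrite -size_s ltnS index_mem.
apply: (@determinant_alternate _ _ _ (Ordinal row0) (Ordinal row_x)) => // b.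
by rewrite !mxE /= (nth_map x) ?index_mem // nth_index.
Qed.

End RowsDet.

Section EnumOrdinals.

Variable n : nat.
Implicit Types (J : {set 'I_n}) (p : 'I_n).

Definition rank_in J p : nat := #|[set x in J | (x < p)%N]|.

Lemma enum_ord_sorted J : sorted (relpre val ltn) (enum J).
Proof.
rewrite {1}/enum_mem -enumT sorted_filter //; first by move=> y x z; apply: ltn_trans.
by rewrite -sorted_map val_enum_ord iota_ltn_sorted.
Qed.

Lemma enum_setU1 J p : p \notin J -> exists s1 s2,
  [/\ enum J = s1 ++ s2, enum (p |: J) = s1 ++ p :: s2 & size s1 = rank_in J p].
Proof.
move=> pJ; pose below := [pred x : 'I_n | (x < p)%N].
have lt_trans : transitive (relpre (val : 'I_n -> nat) ltn).
  by move=> y x z; apply: ltn_trans.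
have enum_pairwise := enum_ord_sorted J; rewrite sorted_pairwise // in enum_pairwise.
have above_p x : x \in [seq y <- enum J | ~~ below y] -> (p < x)%N.
  rewrite mem_filter mem_enum /= -leqNgt leq_eqVlt => /andP[/predU1P[eq_px|//] xJ].
  by case/negP: pJ; rewrite (val_inj eq_px).
have below_p x : x \in [seq y <- enum J | below y] -> (x < p)%N.
  by rewrite mem_filter => /andP[].
exists [seq x <- enum J | below x], [seq x <- enum J | ~~ below x].
have lt_irr : irreflexive (relpre (val : 'I_n -> nat) ltn) by move=> x /=; rewrite ltnn.
split.
- apply: (irr_sorted_eq lt_trans lt_irr (enum_ord_sorted J)) => [|x].
    rewrite sorted_pairwise // pairwise_cat !(pairwise_filter _ enum_pairwise) /= ?andbT.
    apply/allrelP => x y /below_p lt_xp /above_p; exact: ltn_trans.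
  by rewrite mem_cat !mem_filter; case: (below x); rewrite ?orbF.
- have eq_mem : enum (p |: J)
      =i [seq x <- enum J | below x] ++ p :: [seq x <- enum J | ~~ below x].
    move=> x; rewrite mem_enum in_setU1 mem_cat in_cons.
    rewrite !(mem_filter _ _ (enum J)) mem_enum.
    by case: (below x); rewrite ?orbF //= orbC.
  apply: (irr_sorted_eq lt_trans lt_irr (enum_ord_sorted _) _ eq_mem).
  rewrite sorted_pairwise // pairwise_cat /= !(pairwise_filter _ enum_pairwise) /= ?andbT.
  apply/andP; split; last by apply/allP.
  apply/allrelP => x y /below_p lt_xp; rewrite inE => /predU1P[->//|/above_p].
  exact: ltn_trans.
- rewrite -sum1_size big_filter big_enum_cond /rank_in -sum1_card.
  by apply: eq_bigl => x; rewrite inE.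
Qed.

End EnumOrdinals.

Lemma mulmx_inj_unitmx (F : fieldType) (n : nat) (A : 'M[F]_n) :
  (forall w : 'cV[F]_n, A *m w = 0 -> w = 0) -> A \in unitmx.
Proof.
move=> A_inj; rewrite -unitmx_tr unitmxE unitfE; apply/negP => /det0P[u u_neq0 uA].
case/negP: u_neq0; rewrite -[u]trmxK (A_inj u^T) ?trmx0 //.
by rewrite -[LHS]trmxK trmx_mul trmxK uA trmx0.
Qed.

Lemma mulmx_sum_col (R : comNzRingType) (m n : nat) (A : 'M[R]_(m, n)) (v : 'cV[R]_n) :
  A *m v = \sum_j v j 0 *: col j A.
Proof.
apply/matrixP => a c; rewrite ord1 !mxE summxE; apply: eq_bigr => j _.
by rewrite !mxE mulrC.
Qed.

Section Frame.

Variables (F : fieldType) (n r : nat) (M : {vspace 'cV[F]_n}).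
Hypothesis dimM : \dim M = r.
Implicit Types (J : {set 'I_n}) (p q : 'I_n) (v : 'cV[F]_n).

Lemma frame_mulE (w : 'cV[F]_r) : frame r M *m w = \sum_(j < r) w j 0 *: (vbasis M)`_j.
Proof.
rewrite mulmx_sum_col; apply: eq_bigr => j _; congr (_ *: _).
by apply/matrixP => i c; rewrite ord1 !mxE.
Qed.

Lemma memv_frame (w : 'cV[F]_r) : frame r M *m w \in M.
Proof.
rewrite frame_mulE; apply: memv_suml => j _; apply/memvZ/vbasis_mem/mem_nth.
by rewrite size_tuple dimM.
Qed.

Lemma frame_surj v : v \in M -> exists w : 'cV[F]_r, v = frame r M *m w.
Proof.
move=> vM; exists (\col_j coord (vbasis M) (cast_ord (esym dimM) j) v).
rewrite frame_mulE {1}(coord_vbasis vM) (reindex (cast_ord (esym dimM))) /=.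
  by apply: eq_bigr => j _; rewrite mxE.
by exists (cast_ord dimM) => j _; rewrite ?cast_ordK ?cast_ordKV.
Qed.

Lemma frame_inj (w : 'cV[F]_r) : frame r M *m w = 0 -> w = 0.
Proof.
rewrite frame_mulE => w0; apply/matrixP => j c; rewrite ord1 [RHS]mxE.
have /andP[_ /freeP free_basis] := vbasisP M.
rewrite -(cast_ordKV dimM j).
apply: (free_basis (fun i => w (cast_ord dimM i) 0)); apply: etrans w0.
rewrite [RHS](reindex (cast_ord dimM)) //.
by exists (cast_ord (esym dimM)) => i _; rewrite ?cast_ordK ?cast_ordKV.
Qed.

Definition max_minor J : F := rows_det (frame r M) (enum J).

Lemma pluckerE I : plucker r M I
  = if #|residues n I| == r then max_minor (residues n I) else 0.
Proof. by []. Qed.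

Lemma max_minor_neq0P J : #|J| = r ->
  max_minor J != 0 <->
  (forall v, v \in M -> (forall x, x \in J -> v x 0 = 0) -> v = 0).
Proof.
move=> card_J; rewrite /max_minor /rows_det; set Q := \matrix_(a, b) _.
have QE x0 a (w : 'cV[F]_r) : (Q *m w) a 0 = (frame r M *m w) (nth x0 (enum J) a) 0.
  rewrite !mxE; apply: eq_bigr => b _; rewrite !mxE (nth_map x0) ?mxE //.
  by rewrite -cardE card_J.
split=> [detQ v /frame_surj[w ->] v0|v0].
  have Q_unit : Q \in unitmx by rewrite unitmxE unitfE.
  rewrite -(mulKmx Q_unit w) (_ : Q *m w = 0) ?mulmx0 //.
  apply/matrixP => a c; rewrite ord1 [RHS]mxE.
  have [x0 _] : exists x0, x0 \in J.
    by apply/card_gt0P; rewrite card_J; apply: leq_ltn_trans (ltn_ord a).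
  by rewrite (QE x0) v0 // -mem_enum mem_nth // -cardE card_J.
rewrite -unitfE -unitmxE; apply: mulmx_inj_unitmx => w Qw; apply: frame_inj.
apply: v0 => [|x xJ]; first exact: memv_frame.
have x_index : (index x (enum J) < r)%N by rewrite -card_J cardE index_mem mem_enum.
have := QE x (Ordinal x_index) w.
by rewrite Qw /= nth_index ?mem_enum // mxE.
Qed.

Lemma max_minor_setU1 J p : #|J|.+1 = r -> p \notin J ->
  max_minor (p |: J)
  = (-1) ^+ rank_in J p * (frame r M *m minors_col (frame r M) (enum J)) p 0.
Proof.
move=> card_J /enum_setU1[s1 [s2 [enumJ enum_pJ <-]]].
by rewrite /max_minor enum_pJ rows_det_expand -enumJ // -cardE.
Qed.

(* When the minor on q |: J is nonzero, the vectors of M vanishing on J form a line, which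
   contains the vector of the minors on p |: J. *)
Lemma max_minor_ratio J p q v : #|J|.+1 = r -> p \notin J -> q \notin J ->
  max_minor (q |: J) != 0 -> v \in M -> (forall x, x \in J -> v x 0 = 0) -> v q 0 != 0 ->
  max_minor (p |: J) / max_minor (q |: J)
  = (-1) ^+ (rank_in J p + rank_in J q) * (v p 0 / v q 0).
Proof.
move=> card_J pJ qJ minor_q vM v0 vq.
have card_qJ : #|q |: J| = r by rewrite cardsU1 qJ.
have mM := memv_frame (minors_col (frame r M) (enum J)).
rewrite !max_minor_setU1 // in minor_q *; set m := frame r M *m _ in mM minor_q *.
have mq : m q 0 != 0 by move: minor_q; rewrite mulf_eq0 negb_or => /andP[].
have m0 x : x \in J -> m x 0 = 0.
  by move=> xJ; rewrite /m minors_col_orth ?mem_enum // -cardE.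
have entryE (u w : 'cV[F]_n) a b x : (a *: u - b *: w) x 0 = a * u x 0 - b * w x 0.
  by rewrite !mxE.
have prop : m q 0 *: v - v q 0 *: m = 0.
  rewrite -max_minor_setU1 // in minor_q.
  apply: ((max_minor_neq0P card_qJ).1 minor_q); first by rewrite memvB ?memvZ.
  move=> x; rewrite entryE => /setU1P[->|xJ]; first by rewrite mulrC subrr.
  by rewrite (v0 x) // (m0 x) // !mulr0 subrr.
have mp : m q 0 * v p 0 = v q 0 * m p 0.
  by apply/eqP; rewrite -subr_eq0 -entryE prop mxE.
rewrite invfM invr_sign exprD -!mulrA; congr (_ * _); rewrite mulrCA; congr (_ * _).
by apply/eqP; rewrite eqr_div // mulrC -mp mulrC.
Qed.

End Frame.

(** * Cyclic intervals and the columns of g *)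

Section CyclicIntervals.

Variable n : nat.
Implicit Types (d b : nat) (p q x : 'I_n).

(* The d residues that precede b cyclically. *)
Definition cyc_arc d b : {set 'I_n} :=
  [set x : 'I_n |
    if (d <= b)%N then (b - d <= x < b)%N else ((x < b) || (n + b - d <= x))%N].

Definition arc_start d b : nat := if (d <= b)%N then (b - d)%N else (n + b - d)%N.

Lemma mem_intervalz (a c i : int) : (i \in intervalz a c) = (a <= i <= c).
Proof.
rewrite /intervalz; case: ifP => le_ac; last by rewrite in_nil; lia.
apply/mapP/idP => [[d]|ac_i]; first by rewrite mem_iota => d_lt ->; lia.
by exists `|i - a|%N; rewrite ?mem_iota; lia.
Qed.

Lemma residues_interval d b : (b < n)%N -> (d < n)%N ->
  residues n (intervalz (b.+1%:Z - d%:Z) (b.+1%:Z - 1)) = cyc_arc d b.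
Proof.
move=> lt_bn lt_dn; apply/setP => x; have lt_xn := ltn_ord x; rewrite !inE.
apply/hasP/idP => [[z]|x_arc].
  rewrite mem_intervalz eqz_mod_dvd => z_bounds /dvdzP[c def_c].
  have [c0|c1] : c = 0 \/ c = -1 by nia.
    by rewrite c0 in def_c; case: ifP; lia.
  by rewrite c1 in def_c; case: ifP; lia.
have [lt_xb|le_bx] := ltnP x b.
  exists x.+1%:Z; last by rewrite eqz_mod_dvd subrr dvdz0.
  by rewrite mem_intervalz; move: x_arc; case: ifP; lia.
exists (x.+1%:Z - n%:Z).
  by rewrite mem_intervalz; move: x_arc; case: ifP; lia.
by rewrite eqz_mod_dvd; apply/dvdzP; exists (-1); lia.
Qed.

Lemma residues_rcons (I : seq int) p : residues n (rcons I p.+1%:Z) = p |: residues n I.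
Proof.
apply/setP => x; rewrite in_setU1 !inE has_rcons; congr (_ || _).
have lt_xn := ltn_ord x; have lt_pn := ltn_ord p.
rewrite eqz_mod_dvd; apply/dvdzP/eqP => [[c def_c]|->]; last by exists 0; lia.
by apply: val_inj => /=; have c0 : c = 0 by [nia]; rewrite c0 in def_c; lia.
Qed.

Lemma arc_start_lt d b : (b < n)%N -> (0 < d)%N -> (arc_start d b < n)%N.
Proof. by rewrite /arc_start; case: ifP; lia. Qed.

Lemma arc_start_notin d b q : (b < n)%N -> (d < n)%N -> q = arc_start d.+1 b :> nat ->
  q \notin cyc_arc d b.
Proof. by move=> lt_bn lt_dn; rewrite inE /arc_start => ->; do 2!case: ifP; lia. Qed.

Lemma cyc_arcS d b q : (b < n)%N -> (d < n)%N -> q = arc_start d.+1 b :> nat ->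
  cyc_arc d.+1 b = q |: cyc_arc d b.
Proof.
move=> lt_bn lt_dn qE; apply/setP => x; rewrite in_setU1 -val_eqE /= qE !inE /arc_start.
by have := ltn_ord x; do 2!case: ifP; lia.
Qed.

Lemma card_cyc_arc d b : (b < n)%N -> (d <= n)%N -> #|cyc_arc d b| = d.
Proof.
move=> lt_bn; elim: d => [|d IH] lt_dn.
  by apply/eqP; rewrite cards_eq0; apply/eqP/setP => x; rewrite !inE leq0n; lia.
pose q : 'I_n := Ordinal (arc_start_lt lt_bn (ltn0Sn d)).
rewrite (cyc_arcS (q := q)) // cardsU1 IH ?(ltnW lt_dn) //.
by rewrite (@arc_start_notin d b q).
Qed.

Lemma card_ord_lt c : (c <= n)%N -> #|[set x : 'I_n | (x < c)%N]| = c.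
Proof.
move=> le_cn; rewrite -sum1_card (eq_bigl (fun x : 'I_n => (x < c)%N)).
  by rewrite (big_ord_narrow le_cn) sum1_card card_ord.
by move=> x; rewrite inE.
Qed.

Lemma rank_in_cyc_arc d b p : (b < n)%N -> (d < n)%N -> p \notin cyc_arc d b ->
  rank_in (cyc_arc d b) p = if (d <= b)%N then (if (b <= p)%N then d else 0%N) else b.
Proof.
move=> lt_bn lt_dn; rewrite inE /rank_in; have lt_pn := ltn_ord p.
have [le_db|lt_bd] := leqP d b => p_out.
  have [le_bp|lt_pb] := leqP b p.
    rewrite -[RHS](card_cyc_arc lt_bn (ltnW lt_dn)); congr #|pred_of_set _|.
    by apply/setP => x; rewrite !inE le_db; lia.
  by apply/eqP; rewrite cards_eq0; apply/eqP/setP => x; rewrite !inE le_db; lia.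
rewrite -[RHS](card_ord_lt (ltnW lt_bn)); congr #|pred_of_set _|.
by apply/setP => x; rewrite !inE leqNgt lt_bd /=; lia.
Qed.

Lemma signr_rank_in_arc (R : pzRingType) r b p q : (b < n)%N -> (0 < r < n)%N ->
  p \notin cyc_arc r.-1 b -> q = arc_start r b :> nat ->
  (-1) ^+ (rank_in (cyc_arc r.-1 b) p + rank_in (cyc_arc r.-1 b) q)
  = (if (r <= b)%N && (b <= p)%N then (-1) ^+ r.-1 else 1) :> R.
Proof.
move=> lt_bn r_bounds pJ qE; have lt_rn : (r.-1 < n)%N by lia.
have qJ : q \notin cyc_arc r.-1 b by apply: arc_start_notin; rewrite ?prednK //; lia.
rewrite !rank_in_cyc_arc //; have [le_rb|lt_br] := leqP r b.
  have -> : (r.-1 <= b)%N = true by lia.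
  have -> : (b <= q)%N = false by rewrite qE /arc_start le_rb; lia.
  by rewrite addn0; case: ifP.
have rank_b (x : 'I_n) : x \notin cyc_arc r.-1 b ->
    (if (r.-1 <= b)%N then if (b <= x)%N then r.-1 else 0%N else b) = b.
  by rewrite inE; case: (leqP r.-1 b) => // le_rb; case: (leqP b x) => //; lia.
by rewrite !rank_b // addnn -signr_odd odd_double.
Qed.

End CyclicIntervals.

Section GColumns.

Variables (F : fieldType) (n r : nat) (M : {vspace 'cV[F]_n}) (t : F).
Hypotheses (r_bounds : (0 < r < n)%N) (dimM : \dim M = r).
Implicit Types (a b q : 'I_n) (v : 'cV[F]_n).

Let interval_r b : residues n (intervalz (b.+1%:Z - r%:Z) (b.+1%:Z - 1)) = cyc_arc n r b.
Proof. by apply: residues_interval; have := ltn_ord b; lia. Qed.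

Let interval_pred_r b :
  residues n (intervalz (b.+1%:Z - r%:Z + 1) (b.+1%:Z - 1)) = cyc_arc n r.-1 b.
Proof.
rewrite (_ : b.+1%:Z - r%:Z + 1 = b.+1%:Z - r.-1%:Z); last by lia.
by apply: residues_interval; have := ltn_ord b; lia.
Qed.

Lemma plucker_arc_neq0P b :
  plucker r M (intervalz (b.+1%:Z - r%:Z) (b.+1%:Z - 1)) != 0 <->
  (forall v, v \in M -> (forall x, x \in cyc_arc n r b -> v x 0 = 0) -> v = 0).
Proof.
have card_arc : #|cyc_arc n r b| = r by rewrite card_cyc_arc //; lia.
by rewrite pluckerE interval_r card_arc eqxx; apply: max_minor_neq0P.
Qed.

(* The vector of M that vanishes on [j-r+1, j-1] is column j of g up to a scalar, apart
   from the factors t and lambda. *)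
Lemma gmat_column a b q v : q = arc_start n r b :> nat -> v \in M ->
  (forall x, x \in cyc_arc n r.-1 b -> v x 0 = 0) -> v q 0 != 0 ->
  plucker r M (intervalz (b.+1%:Z - r%:Z) (b.+1%:Z - 1)) != 0 ->
  gmat r M t a b =
    if (b < r)%N then (v a 0 / v q 0)%:P
    else (if (b <= a)%N then ((-1) ^+ r.-1 * t)%:P else 'X) * (v a 0 / v q 0)%:P.
Proof.
move=> qE vM v0 vq minor_neq0; set J := cyc_arc n r.-1 b in v0.
have lt_bn := ltn_ord b; have lt_rn : (r.-1 < n)%N by lia.
have qE' : q = arc_start n r.-1.+1 b :> nat by rewrite prednK ?qE; lia.
have qJ : q \notin J := arc_start_notin lt_bn lt_rn qE'.
have card_J : #|J| = r.-1 by rewrite card_cyc_arc //; lia.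
have card_J1 : #|J|.+1 = r by rewrite card_J prednK //; lia.
have arc_r : cyc_arc n r b = q |: J.
  by rewrite -(cyc_arcS lt_bn lt_rn qE') prednK //; lia.
have card_arc : #|q |: J| = r by rewrite cardsU1 qJ.
rewrite mxE /=; move: minor_neq0.
rewrite !pluckerE residues_rcons interval_r interval_pred_r arc_r card_arc eqxx -/J.
move=> minor_neq0; have [aJ|aJ] := boolP (a \in J).
  rewrite (v0 a aJ) (setUidPr _) ?sub1set // card_J.
  have -> : (r.-1 == r) = false by lia.
  by rewrite !mul0r !mulr0 if_same.
rewrite cardsU1 aJ add1n card_J1 eqxx.
rewrite (max_minor_ratio dimM card_J1 aJ qJ minor_neq0 vM v0 vq).
rewrite signr_rank_in_arc // ltnS; have [le_rb|lt_br] := leqP r b; last by rewrite !mul1r.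
by case: (leqP b a) => _; rewrite ?mul1r // !polyCM mulrCA mulrA.
Qed.

End GColumns.

(** * Column spans and the map Theta *)

Section ColumnSpans.

Variables (F : fieldType) (n : nat).
Implicit Types (m : nat) (A : 'M[F]_n) (v : 'cV[F]_n).

Lemma memv_col_span m A (j : 'I_n) : (j < m)%N -> col j A \in span_cols m A.
Proof. by move=> lt_jm; apply/memv_span/map_f; rewrite mem_filter lt_jm mem_enum. Qed.

Lemma span_colsP m A v : v \in span_cols m A <->
  exists2 w : nat -> F, supported_below m w & v = A *m natcol n w.
Proof.
split=> [v_span|[w w0 ->]]; last first.
  rewrite mulmx_sum_col; apply: memv_suml => j _; rewrite mxE.
  have [le_mj|lt_jm] := leqP m j; first by rewrite w0 // scale0r mem0v.
  exact/memvZ/memv_col_span.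
pose D : 'M[F]_n := diag_mx (\row_j (j < m)%N%:R).
have /subvP/(_ v v_span)/memv_imgP[w _ ->] : (span_cols m A
    <= limg (linfun (mulmx (A *m D) : 'cV[F]_n -> 'cV[F]_n)))%VS.
  apply/span_subvP => u /mapP[j]; rewrite mem_filter => /andP[lt_jm _] ->.
  apply/memv_imgP; exists (delta_mx j 0); first exact: memvf.
  rewrite lfunE /= -mulmxA mul_diag_mx colE; congr (_ *m _).
  apply/matrixP => a b; rewrite !mxE; case: eqP => [->|_]; rewrite ?mulr0 //.
  by rewrite lt_jm mul1r.
have [u -> _] := natcol_surj w; rewrite lfunE /= -mulmxA.
exists (fun a => (a < m)%N%:R * u a) => [a le_ma|]; first by rewrite ltnNge le_ma mul0r.
by congr (_ *m _); apply/matrixP => a b; rewrite mul_diag_mx !mxE.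
Qed.

Lemma dim_span_cols m A : (m <= n)%N -> A \in unitmx -> \dim (span_cols m A) = m.
Proof.
move=> le_mn A_unit; pose cols s := [seq col j A | j : 'I_n <- s].
have free_cols : free (cols (enum 'I_n)).
  apply/(@freeP _ _ _ (mktuple (fun j => col j A))) => c sum0 j.
  have : A *m \col_i c i = 0.
    rewrite mulmx_sum_col -[RHS]sum0; apply: eq_bigr => i _.
    by rewrite mxE -tnth_nth tnth_mktuple.
  move/(congr1 (mulmx (invmx A))); rewrite mulKmx // mulmx0 => /matrixP/(_ j 0).
  by rewrite !mxE.
have : free (cols [seq j : 'I_n <- enum 'I_n | (j < m)%N]).
  apply: (@catl_free _ _ (cols [seq j : 'I_n <- enum 'I_n | ~~ (j < m)%N])).
  by rewrite -map_cat (perm_free (perm_map _ (permEl (perm_filterC _ _)))).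
rewrite /free -/(span_cols m A) => /eqP ->.
rewrite size_map -sum1_size big_filter big_enum_cond.
by rewrite (big_ord_narrow le_mn) sum1_card card_ord.
Qed.

End ColumnSpans.

Section ExtendedEntries.

Variables (F : fieldType) (n k : nat).
Hypothesis k_bounds : (1 <= k < n)%N.
Implicit Types x y : rpoint n k F.

Definition ext_entry x (i l : nat) : F :=
  if l == (i + (n - k))%N then x.2 else entry x i l.

Lemma ext_entry_last x i : ext_entry x i (i + (n - k)) = x.2.
Proof. by rewrite /ext_entry eqxx. Qed.

Lemma ext_entryE x i l : (l < i + (n - k))%N -> ext_entry x i l = entry x i l.
Proof. by move=> lt_l; rewrite /ext_entry ltn_eqF. Qed.

Lemma ext_entry_neq0 x i l : in_torus x -> (1 <= i <= k)%N -> (i <= l <= i + (n - k))%N ->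
  ext_entry x i l != 0.
Proof.
move=> x_torus i_bounds l_bounds; rewrite /ext_entry.
case: ifP => [_|/eqP ne]; first exact: (x_torus None).
by apply: entry_neq0 => //; rewrite /in_R; lia.
Qed.

Lemma PhiE x :
  Phi x = \prod_(i <- rev (index_iota 1 k.+1)) Mint n i (i + (n - k)) (ext_entry x i).
Proof. by apply: eq_bigr => i _; rewrite /ext_entry addnBA //; lia. Qed.

Lemma Phi_natcol x w : Phi x *m natcol n w = natcol n (Phi_act (n - k) (ext_entry x) k w).
Proof. by rewrite PhiE prod_Mint_natcol //; lia. Qed.

Lemma Phi_entryE x (a b : 'I_n) :
  Phi x a b = Phi_act (n - k) (ext_entry x) k (dirac F b) a.
Proof.
transitivity ((Phi x *m natcol n (dirac F b)) a 0); last by rewrite Phi_natcol mxE.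
rewrite (_ : natcol n _ = delta_mx b 0) -?colE ?mxE //.
by apply/matrixP => i j; rewrite ord1 !mxE eqxx andbT.
Qed.

Lemma Phi_tri x (a b : 'I_n) : (a < b)%N -> Phi x a b = 0.
Proof.
by move=> lt_ab; rewrite Phi_entryE (Phi_act_tri _ _ _ (@dirac_vanishes F b)).
Qed.

End ExtendedEntries.

Section ThetaColumns.

Variables (F : fieldType) (n k : nat).
Hypothesis k_bounds : (1 <= k < n)%N.
Variable x : rpoint n k F.
Hypothesis x_torus : in_torus x.

Let r := (n - k)%N.
Let act := Phi_act r (ext_entry x) k.
Let r_bounds : (0 < r < n)%N. Proof. by rewrite /r; lia. Qed.
Let r_gt0 : (0 < r)%N. Proof. by case/andP: r_bounds. Qed.
Let ext_neq0 i l : (1 <= i <= k)%N -> (i <= l <= i + r)%N -> ext_entry x i l != 0.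
Proof. exact: ext_entry_neq0. Qed.

Lemma memv_Theta v : v \in (Theta x).1 <->
  exists2 w, supported_below r w & v = natcol n (act w).
Proof.
split=> [/span_colsP[w w0 ->]|[w w0 ->]]; first by exists w; rewrite ?Phi_natcol.
by apply/span_colsP; exists w; rewrite ?Phi_natcol.
Qed.

Lemma Phi_unitmx : Phi x \in unitmx.
Proof.
apply: mulmx_inj_unitmx => v; have [w -> _] := natcol_surj v.
rewrite Phi_natcol // => act0; apply/matrixP => a c; rewrite !mxE.
apply: (Phi_act_low_eq0 ext_neq0 (leqnn k) (c := n)) => [a' lt_a'n|]; last exact: ltn_ord.
by have /matrixP/(_ (Ordinal lt_a'n) 0) := act0; rewrite !mxE.
Qed.

Lemma dim_Theta : \dim (Theta x).1 = r.
Proof. by rewrite dim_span_cols ?Phi_unitmx //; lia. Qed.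

Lemma Theta_in_grass : in_grass r (Theta x).
Proof. by rewrite /in_grass dim_Theta eqxx (x_torus None). Qed.

Lemma plucker_Theta_neq0 (b : 'I_n) :
  plucker r (Theta x).1 (intervalz (b.+1%:Z - r%:Z) (b.+1%:Z - 1)) != 0.
Proof.
apply/(plucker_arc_neq0P r_bounds dim_Theta) => _ /memv_Theta[w w0 ->] act0.
have act_arc a : (a < n)%N ->
    (if r <= b then b - r <= a < b else (a < b) || (n + b - r <= a))%N -> act w a = 0.
  by move=> lt_an a_arc; have := act0 (Ordinal lt_an); rewrite mxE inE; apply.
suff w_eq0 : supported_below 0 w.
  apply/matrixP => a c; rewrite !mxE.
  by apply: (Phi_act_tri _ _ _ (s := n)) (ltn_ord a) => a' _; apply: w_eq0.
case: (leqP r b) act_arc => [le_rb|lt_br] act_arc.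
  apply: (Phi_act_window_eq0 ext_neq0 (leqnn k) (s := b - r) _ w0) => [|d d_bounds].
    by have := ltn_ord b; rewrite /r; lia.
  by apply: act_arc; have := ltn_ord b; lia.
have w_low : vanishes_on 0 b w.
  by apply: (Phi_act_low_eq0 ext_neq0 (leqnn k)) => d lt_db; apply: act_arc; lia.
have w_high : supported_below b w.
  apply: (Phi_act_high_eq0 (m := k) w0) => d d_bounds.
  by apply: act_arc; rewrite /r in d_bounds *; lia.
by move=> d _; have [/w_low|/w_high] := ltnP d b.
Qed.

Lemma gmat_Theta_left (a b : 'I_n) : (b < r)%N ->
  gmat r (Theta x).1 x.2 a b = (Phi x a b)%:P.
Proof.
move=> lt_br; pose q : 'I_n := Ordinal (arc_start_lt (ltn_ord b) r_gt0).
pose v := natcol n (act (dirac F b)).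
have vM : v \in (Theta x).1.
  by apply/memv_Theta; exists (dirac F b) => // c le_rc; apply: dirac_supported; lia.
have v0 y : y \in cyc_arc n r.-1 b -> v y 0 = 0.
  rewrite inE mxE => y_arc; have [lt_yb|le_by] := ltnP y b.
    exact: (Phi_act_tri _ _ _ (@dirac_vanishes F b)).
  apply: (Phi_act_band _ _ (@dirac_supported F b)).
  by move: y_arc; rewrite /r; case: ifP; lia.
have vq : v q 0 = 1.
  have -> : v q 0 = act (dirac F b) (k + b)%N.
    by rewrite mxE /= /arc_start leqNgt lt_br; congr (act _ _); rewrite /r /=; lia.
  by rewrite /act Phi_act_edge ?dirac_diag //; apply: dirac_supported.
have qE : q = arc_start n r b :> nat by [].
have vq_neq0 : v q 0 != 0 by rewrite vq oner_neq0.
rewrite (gmat_column _ r_bounds dim_Theta a qE vM v0 vq_neq0 (plucker_Theta_neq0 b)).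
by rewrite lt_br vq divr1 Phi_entryE // mxE.
Qed.

Lemma gmat_Theta_right (a b : 'I_n) : (r <= b)%N ->
  if (b <= a)%N then gmat r (Theta x).1 x.2 a b = (Phi x a b)%:P
  else exists2 c, gmat r (Theta x).1 x.2 a b = 'X * c%:P & (k <= a)%N -> c = 0.
Proof.
move=> le_rb; pose q : 'I_n := Ordinal (arc_start_lt (ltn_ord b) r_gt0).
have lt_bn := ltn_ord b; have lt_sk : (b - r < k)%N by rewrite /r; lia.
have ext_last i : (1 <= i <= k)%N -> ext_entry x i (i + r) = x.2.
  by rewrite ext_entry_last.
have [w [w0 w_dirac w_s]] := Phi_act_twist ext_neq0 r_gt0 ext_last (leqnn k) lt_sk.
rewrite subnK // -/act in w_dirac; pose v := natcol n (act w).
have vM : v \in (Theta x).1 by apply/memv_Theta; exists w.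
have v_between (y : 'I_n) : (b - r < y < b)%N -> v y 0 = 0.
  case/andP=> lt_y lt_yb; rewrite mxE w_dirac //.
  exact: (Phi_act_tri _ _ _ (@dirac_vanishes F b)).
have v0 y : y \in cyc_arc n r.-1 b -> v y 0 = 0.
  by rewrite inE => y_arc; apply: v_between; move: y_arc; case: ifP; lia.
have vq : v q 0 = (-1) ^+ r.-1 * x.2 by rewrite mxE /= /arc_start le_rb.
have vq_neq0 : v q 0 != 0 by rewrite vq mulf_neq0 ?signr_eq0 ?(x_torus None).
have minor_neq0 := plucker_Theta_neq0 b.
have qE : q = arc_start n r b :> nat by [].
rewrite (gmat_column _ r_bounds dim_Theta a qE vM v0) //.
rewrite ltnNge le_rb /=; case: (leqP b a) => [le_ba|lt_ab].
  by rewrite -polyCM -vq mulrC divfK // Phi_entryE // mxE w_dirac //; lia.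
by exists (v a 0 / v q 0) => // le_ka; rewrite v_between ?mul0r //; lia.
Qed.

(* In the last n - k rows, the only ones that S uses, the entries of g involving lambda
   vanish. *)
Lemma horner_gmat_Theta (a b : 'I_n) (lam : F) : (k <= a)%N \/ lam = 0 ->
  (gmat r (Theta x).1 x.2 a b).[lam] = Phi x a b.
Proof.
have [lt_br|le_rb] := ltnP b r; first by rewrite gmat_Theta_left ?hornerC.
move=> lam_cond; have := gmat_Theta_right a le_rb.
case: leqP => [_ ->|lt_ab [c -> c0]]; first by rewrite hornerC.
rewrite Phi_tri // hornerM hornerX hornerC.
by case: lam_cond => [/c0 ->|->]; rewrite ?mulr0 ?mul0r.
Qed.

End ThetaColumns.

Lemma Theta_inj (F : fieldType) (n k : nat) (x y : rpoint n k F) : (1 <= k < n)%N ->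
  in_torus x -> in_torus y -> Theta x = Theta y -> x = y.
Proof.
move=> k_bounds x_torus y_torus eq_Theta; have eq_t : x.2 = y.2 := congr1 snd eq_Theta.
have eq_Phi : Phi x = Phi y.
  have Phi_g z (a b : 'I_n) : in_torus z ->
      Phi z a b = (gmat (n - k) (@Theta F n k z).1 z.2 a b).[0].
    by move=> z_torus; rewrite horner_gmat_Theta //; right.
  apply/matrixP => a b.
  by rewrite (Phi_g x a b x_torus) (Phi_g y a b y_torus) eq_Theta eq_t.
have eq_act w a : (a < n)%N ->
    Phi_act (n - k) (ext_entry x) k w a = Phi_act (n - k) (ext_entry y) k w a.
  move=> lt_an; have := Phi_natcol k_bounds x w; rewrite eq_Phi Phi_natcol //.
  by move/matrixP/(_ (Ordinal lt_an) 0); rewrite !mxE.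
apply: coord_at_inj => -[p|] //=; have := in_R_Rset p; rewrite /in_R => p_R.
rewrite -!entry_Rset -!ext_entryE; try lia.
apply: (Phi_act_inj (k := k) (N := n) _ _ _ (leqnn k) eq_act); try lia.
by move=> i l; apply: ext_entry_neq0.
Qed.

(** * The map S *)

Lemma big_rev_nat (R : Type) (idx : R) (op : R -> R -> R) (a b d : nat) (f : nat -> R) :
  \big[op/idx]_(l <- rev (index_iota a (a + d))) f l
  = \big[op/idx]_(b <= l < b + d) f (a + b + d - l.+1)%N.
Proof.
rewrite -(big_map (fun l => a + b + d - l.+1)%N xpredT f); congr (\big[_/_]_(_ <- _) _).
apply: (@eq_from_nth _ 0%N) => [|i]; rewrite size_rev ?size_map !size_iota; first by lia.
move=> lt_id; rewrite nth_rev ?size_iota // (nth_map 0%N) ?size_iota ?nth_iota; lia.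
Qed.

Section Flip.

Variables (F : fieldType) (n : nat).
Implicit Types (A B : 'M[F]_n) (c t : F).

Lemma fl_mul A B : fl (A * B) = fl B * fl A.
Proof.
apply/matrixP => a b; rewrite -!mulmxE !mxE (reindex_inj rev_ord_inj) /=.
by apply: eq_bigr => j _; rewrite !mxE mulrC.
Qed.

Lemma fl_diag_mx (d : 'rV[F]_n) : fl (diag_mx d) = diag_mx (\row_j d 0 (rev_ord j)).
Proof.
apply/matrixP => a b; rewrite !mxE (inj_eq rev_ord_inj) eq_sym.
by case: eqP => [->|].
Qed.

Lemma fl1 : fl (1 : 'M[F]_n) = 1.
Proof. by apply/matrixP => a b; rewrite !mxE (inj_eq rev_ord_inj) eq_sym. Qed.

Lemma fl_prod (s : seq nat) (A : nat -> 'M[F]_n) :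
  fl (\prod_(i <- s) A i) = \prod_(i <- rev s) fl (A i).
Proof.
elim: s => [|i s IH]; first by rewrite !big_nil fl1.
by rewrite big_cons fl_mul IH rev_cons -cats1 big_cat big_seq1.
Qed.

Lemma fl_xminus l c : (1 <= l < n)%N -> fl (xminus n l c) = xminus n (n - l) c^-1.
Proof.
move=> l_bounds; apply/matrixP => a b; have lt_an := ltn_ord a; have lt_bn := ltn_ord b.
rewrite !xminusE !mxE (inj_eq rev_ord_inj) /= invrK !eqSS; congr (_ + _).
  rewrite [b == a]eq_sym; case: (eqVneq a b) => [->|_]; last by rewrite !mulr0n.
  rewrite !mulr1n.
  rewrite (_ : ((n - b.+1).+1 == l) = ((b : nat) == n - l)%N); last by lia.
  rewrite (_ : (n - b.+1 == l)%N = (b.+1 == n - l)%N); last by lia.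
  by case: (eqVneq (b : nat) (n - l)%N) => [<-|//]; rewrite (gtn_eqF (ltnSn b)).
by congr (nat_of_bool _)%:R; lia.
Qed.

Lemma fl_tdiag i c : (1 <= i <= n)%N -> fl (tdiag n i c) = tdiag n (n.+1 - i) c.
Proof.
move=> i_bounds; rewrite !tdiagE fl_diag_mx; congr diag_mx; apply/matrixP => a b.
by have lt_bn := ltn_ord b; rewrite !mxE /=; congr (if _ then _ else _); lia.
Qed.

Lemma tdiag_prod_xminus i d t (c : nat -> F) : (0 < i)%N -> (i + d <= n)%N -> t != 0 ->
  tdiag n i t * \prod_(i <= l < i + d) xminus n l (c l)
  = \prod_(i <= l < i + d) xminus n l (t * c l) * tdiag n (i + d) t.
Proof.
move=> i_gt0 + t0; elim: d => [|d IH] id_le.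
  by rewrite addn0 !big_geq // mulr1 mul1r.
rewrite addnS !big_nat_recr ?leq_addr //= mulrA IH; last by lia.
by rewrite -!mulrA tdiag_xminus //; lia.
Qed.

Lemma fl_Mint i j d (c c' : nat -> F) : (0 < i)%N -> (0 < j)%N -> (i + j + d = n.+1)%N ->
  c (i + d)%N != 0 -> c' (j + d)%N = c (i + d)%N ->
  (forall l, (j <= l < j + d)%N -> c' l = c (i + d)%N / c (n - l)%N) ->
  fl (Mint n i (i + d) c) = Mint n j (j + d) c'.
Proof.
move=> i_gt0 j_gt0 ijd t0 c'_last c'E.
rewrite /Mint !mulmxE fl_mul fl_tdiag ?fl_prod ?(big_rev_nat _ _ i j); last by lia.
rewrite (_ : (n.+1 - (i + d) = j)%N); last by lia.
rewrite c'_last (eq_big_nat _ _ (F2 := fun l => xminus n l (c (n - l)%N)^-1)); last first.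
  move=> l l_bounds; rewrite ijd subSS fl_xminus; last by lia.
  by congr (xminus n _ _); lia.
rewrite tdiag_prod_xminus //; last by lia.
by congr (_ * _); apply: eq_big_nat => l l_bounds; rewrite c'E.
Qed.

End Flip.

Section SMap.

Variables (F : fieldType) (n k : nat).
Hypothesis k_bounds : (1 <= k < n)%N.
Implicit Types x y : rpoint n k F.

Definition rot_map : rpoint n k F -> rpoint n k F :=
  complement_map k (fun i _ => k - i + 1)%N (fun _ j => n - j)%N (F := F).

Lemma in_R_rot i j : in_R n k i j -> in_R n k (k - i + 1) (n - j).
Proof. by rewrite /in_R; lia. Qed.

Lemma rot_map_torus x : in_torus x -> in_torus (rot_map x).
Proof. by apply: complement_map_torus => // i j; apply: in_R_rot. Qed.

Lemma Phi_rot_map x : in_torus x -> Phi (rot_map x) = fl (Phi x).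
Proof.
move=> x_torus; rewrite !PhiE // fl_prod revK -{1}(add1n k) (big_rev_nat _ _ 1 1).
apply: eq_big_nat => i i_bounds; apply/esym.
rewrite (_ : (1 + 1 + k - i.+1 = k.+1 - i)%N); last by lia.
apply: fl_Mint; rewrite ?ext_entry_last ?(x_torus None) //; try lia.
move=> l l_bounds; rewrite !ext_entryE; try lia.
rewrite entry_complement_map //; last by rewrite /in_R; lia.
by congr (_ / entry x _ _); lia.
Qed.

Lemma S_space_Theta x : in_torus x ->
  S_space (n - k) (Theta x).1 x.2 = span_cols (n - k) (fl (Phi x)).
Proof.
move=> x_torus; rewrite /S_space /span_cols; congr span; apply/eq_in_map => j.
rewrite mem_filter => /andP[lt_j _]; apply/matrixP => i c.
rewrite 2![LHS]mxE 2![RHS]mxE /horner_eval [fl _ _ _]mxE horner_gmat_Theta //; left.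
by rewrite /=; lia.
Qed.

Lemma S_graph_rot_map x : in_torus x -> S_graph (n - k) (Theta x) (Theta (rot_map x)).
Proof.
move=> x_torus; have rot_torus := rot_map_torus x_torus; split.
- exact: Theta_in_grass.
- by case=> // j lt_jn; apply: (plucker_Theta_neq0 k_bounds x_torus (Ordinal lt_jn)).
- by rewrite S_space_Theta // -Phi_rot_map.
- exact: Theta_in_grass.
Qed.

Lemma S_conj_graphE x y : in_torus x -> in_torus y -> S_conj_graph x y <-> y = rot_map x.
Proof.
move=> x_torus y_torus; have rot_torus := rot_map_torus x_torus.
split=> [[_ _ Sxy _]|->]; last exact: S_graph_rot_map.
by apply: (Theta_inj k_bounds) => //; have [_ _ -> _] := S_graph_rot_map x_torus.
Qed.

End SMap.

(** * The map D *)

Lemma pairwise_gtn_rev_iota m : pairwise gtn (rev (index_iota 1 m.+1)).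
Proof.
rewrite -sorted_pairwise; first by rewrite rev_sorted iota_ltn_sorted.
by move=> a b c /= lt_ab lt_ca; apply: ltn_trans lt_ca lt_ab.
Qed.

Section OrderedProducts.

Variable R : pzSemiRingType.
Implicit Types (s : seq nat).

Lemma prod_mul_split s (g h : nat -> R) : pairwise gtn s ->
  (forall a a', a \in s -> a' \in s -> (a' < a)%N -> GRing.comm (h a) (g a')) ->
  \prod_(a <- s) (g a * h a) = (\prod_(a <- s) g a) * (\prod_(a <- s) h a).
Proof.
elim: s => [|a s IH] /=; first by rewrite !big_nil mulr1.
case/andP=> /allP lt_s pw_s comm_hg; rewrite !big_cons IH //; last first.
  by move=> b b' bs b's; apply: comm_hg; rewrite inE ?bs ?b's orbT.
have comm_a : GRing.comm (h a) (\prod_(b <- s) g b).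
  rewrite big_seq; apply: commr_prod => b bs.
  by apply: comm_hg (lt_s b bs); rewrite inE ?eqxx ?bs ?orbT.
by rewrite -!mulrA; congr (_ * _); rewrite !mulrA comm_a.
Qed.

Lemma prod_exchange s1 s2 (f : nat -> nat -> R) : pairwise gtn s1 -> pairwise gtn s2 ->
  (forall i i' a a', i \in s1 -> i' \in s1 -> a \in s2 -> a' \in s2 ->
     (i' < i)%N -> (a' < a)%N -> GRing.comm (f i' a) (f i a')) ->
  \prod_(i <- s1) \prod_(a <- s2) f i a = \prod_(a <- s2) \prod_(i <- s1) f i a.
Proof.
move=> + pw2; elim: s1 => [|i s1 IH] /=.
  by move=> _ _; rewrite big_nil big1 // => a _; rewrite big_nil.
case/andP=> /allP lt_s1 pw1 comm_f; rewrite big_cons IH //; last first.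
  by move=> j j' a a' js j's; apply: comm_f; rewrite inE ?js ?j's orbT.
under [RHS]eq_bigr => a _ do rewrite big_cons.
rewrite prod_mul_split // => a a' as2 a's2 lt_a'a.
rewrite big_seq; apply/commr_sym/commr_prod => j js1; apply/commr_sym.
by apply: comm_f (lt_s1 j js1) lt_a'a; rewrite ?inE ?eqxx ?js1 ?orbT.
Qed.

End OrderedProducts.

Section AlternatingFlip.

Variables (F : fieldType) (n : nat).
Implicit Types (A B : 'M[F]_n) (c : F).

Definition sign_mx : 'M[F]_n := diag_mx (\row_i (-1) ^+ i).

Lemma sign_mx_natcol u : sign_mx *m natcol n u = natcol n (fun a => (-1) ^+ a * u a).
Proof. by apply/matrixP => a b; rewrite mul_diag_mx !mxE. Qed.

Lemma sign_mxK : sign_mx * sign_mx = 1.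
Proof.
apply: eq_mulmx_natcol => u; rewrite -mulmxE -mulmxA !sign_mx_natcol mul1mx.
by apply: eq_natcol => a _; rewrite signrMK.
Qed.

Definition altflip A : 'M[F]_n := sign_mx * fl A * sign_mx.

Lemma altflipE A i j : altflip A i j = (-1) ^+ (i + j) * A (rev_ord j) (rev_ord i).
Proof. by rewrite /altflip -!mulmxE mul_mx_diag mul_diag_mx !mxE mulrAC exprD. Qed.

Lemma altflip_mul A B : altflip (A * B) = altflip B * altflip A.
Proof.
by rewrite /altflip fl_mul -!mulrA [sign_mx * (sign_mx * _)]mulrA sign_mxK mul1r.
Qed.

(* B is the image of A under the automorphism A |-> altflip(A)^-1, which amounts to taking
   T_w0 of orthogonal complements of column spans. *)
Definition altdual A B : Prop := altflip A * B = 1.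

Lemma altdual1 : altdual 1 1.
Proof. by rewrite /altdual /altflip fl1 !mulr1 sign_mxK. Qed.

Lemma altdual_mul A A' B B' : altdual A B -> altdual A' B' -> altdual (A * A') (B * B').
Proof.
rewrite /altdual => AB A'B'; rewrite altflip_mul -mulrA [altflip A * _]mulrA AB mul1r.
exact: A'B'.
Qed.

Lemma altdual_prod (s : seq nat) (f g : nat -> 'M[F]_n) :
  (forall i, i \in s -> altdual (f i) (g i)) ->
  altdual (\prod_(i <- s) f i) (\prod_(i <- s) g i).
Proof.
elim: s => [|i s IH] fg; first by rewrite !big_nil; apply: altdual1.
rewrite !big_cons; apply: altdual_mul; first exact/fg/mem_head.
by apply: IH => j js; apply: fg; rewrite inE js orbT.
Qed.

Lemma altdual_xminus l c : (1 <= l < n)%N -> c != 0 ->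
  altdual (xminus n l c) (xminus n (n - l) c).
Proof.
move=> l_bounds c0; apply: eq_mulmx_natcol => u.
rewrite /altflip fl_xminus // -!mulmxE -!mulmxA xminus_natcol; last by lia.
rewrite sign_mx_natcol xminus_natcol ?sign_mx_natcol ?mul1mx; last by lia.
have : (0 < n - l)%N by lia.
move: (n - l)%N => m m_gt0; apply: eq_natcol => a _.
have [_|ne_aS] := eqVneq a.+1 m; first by rewrite mulrCA signrMK mulKf.
have [eq_am|ne_am] := eqVneq a m; last by rewrite signrMK.
case: a eq_am {ne_aS} => [|a] /= eq_am; first by rewrite -eq_am in m_gt0.
rewrite -eq_am eqxx exprS invrK.
by transitivity ((-1) ^+ a * ((-1) ^+ a * u a.+1)); [field | rewrite signrMK].
Qed.

Lemma altdual_tdiag i c : (1 <= i <= n)%N -> c != 0 ->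
  altdual (tdiag n i c) (tdiag n (n.+1 - i) c^-1).
Proof.
move=> i_bounds c0; apply: eq_mulmx_natcol => u.
rewrite /altflip fl_tdiag // -!mulmxE -!mulmxA tdiag_natcol sign_mx_natcol tdiag_natcol.
rewrite sign_mx_natcol mul1mx; apply: eq_natcol => a _.
by case: eqVneq => _; rewrite ?signrMK // [c * _]mulrCA signrMK mulVKf.
Qed.

Lemma altdual_Mint i d (c : nat -> F) : (0 < i)%N -> (i + d <= n)%N ->
  (forall l, (i <= l <= i + d)%N -> c l != 0) ->
  altdual (Mint n i (i + d) c)
    (\prod_(i <= l < i + d) xminus n (n - l) (c l)
     * tdiag n (n.+1 - (i + d)) (c (i + d)%N)^-1).
Proof.
move=> i_gt0 id_le c0; rewrite /Mint mulmxE; apply: altdual_mul.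
  apply: altdual_prod => l; rewrite mem_index_iota => l_bounds.
  by apply: altdual_xminus; [lia | apply: c0; lia].
by apply: altdual_tdiag; [lia | apply: c0; lia].
Qed.

End AlternatingFlip.

Section OrthogonalComplement.

Variables (F : fieldType) (n : nat).
Implicit Types (A B : 'M[F]_n) (u v : 'cV[F]_n).

Lemma mem_perp_span_cols m A v : v \in perp (span_cols m A) <->
  forall b : 'I_n, (b < m)%N -> altform (col b A) v = 0.
Proof.
split=> [/perpP perp_v b lt_bm|perp_v]; first exact/perp_v/memv_col_span.
apply/perpP => _ /span_colsP[w w0 ->]; rewrite mulmx_sum_col /altform.
under eq_bigr => i _ do rewrite summxE mulr_sumr mulr_suml.
rewrite exchange_big big1 //= => b _; have [le_mb|lt_bm] := leqP m b.
  by rewrite big1 // => i _; rewrite !mxE w0 // mul0r mulr0 mul0r.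
rewrite (eq_bigr (fun i : 'I_n => w b * ((-1) ^+ i * col b A i 0 * v i 0))) => [|i _].
  by rewrite -mulr_sumr -/(altform _ _) perp_v ?mulr0.
by rewrite !mxE; ring.
Qed.

Lemma mem_Tw0 (N : {vspace 'cV[F]_n}) u : (u \in Tw0 N) = (\col_i u (rev_ord i) 0 \in N).
Proof.
have w0E v : (\matrix_(i, j) (i == rev_ord j)%:R : 'M[F]_n) *m v = \col_i v (rev_ord i) 0.
  apply/matrixP => i c; rewrite ord1 !mxE (bigD1 (rev_ord i)) //= mxE rev_ordK eqxx mul1r.
  rewrite big1 ?addr0 // => j ne; rewrite mxE.
  case: eqP => [eq_i|_]; last by rewrite mul0r.
  by rewrite eq_i rev_ordK eqxx in ne.
have revK v : \col_i (\col_i v (rev_ord i) 0) (rev_ord i) 0 = v.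
  by apply/matrixP => i c; rewrite ord1 !mxE rev_ordK.
apply/memv_imgP/idP => [[v vN ->]|uN]; first by rewrite lfunE /= w0E revK.
by exists (\col_i u (rev_ord i) 0); rewrite // lfunE /= w0E revK.
Qed.

Lemma altform_col_rev A (b : 'I_n) u : altform (col b A) (\col_i u (rev_ord i) 0)
  = (-1) ^+ (n.-1 + rev_ord b) * (altflip A *m u) (rev_ord b) 0.
Proof.
rewrite mxE (reindex_inj rev_ord_inj) mulr_sumr; apply: eq_bigr => i _.
rewrite altflipE !mxE !rev_ordK !mulrA -exprD; congr (_ * _ * _).
have lt_in := ltn_ord i; rewrite -[LHS]signr_odd -[RHS]signr_odd; congr (_ ^+ _).
by congr nat_of_bool; rewrite /=; lia.
Qed.

Lemma Tw0_perp_span_cols m A B : altdual A B ->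
  Tw0 (perp (span_cols m A)) = span_cols (n - m) B.
Proof.
rewrite /altdual -mulmxE => AB; have BA := mulmx1C AB.
apply/vspaceP => u; rewrite mem_Tw0.
apply/idP/idP => [/mem_perp_span_cols perp_u|/span_colsP[w w0 ->]].
  apply/span_colsP; have [w wE w0] := natcol_surj (altflip A *m u).
  exists w => [a le_a|]; last by rewrite -wE mulmxA BA mul1mx.
  have [le_na|lt_an] := leqP n a; first exact: w0.
  have := perp_u (rev_ord (Ordinal lt_an)); rewrite altform_col_rev rev_ordK wE mxE.
  by move=> /(_ ltac:(rewrite /=; lia))/eqP; rewrite mulf_eq0 signr_eq0 => /eqP.
apply/mem_perp_span_cols => b lt_bm; rewrite altform_col_rev mulmxA AB mul1mx mxE.
by rewrite w0 ?mulr0 //=; lia.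
Qed.

Lemma span_cols_mul_tdiag m A i (c : F) : c != 0 ->
  span_cols m (A * tdiag n i c) = span_cols m A.
Proof.
have sub_span B (d : F) : (span_cols m (B * tdiag n i d) <= span_cols m B)%VS.
  apply/subvP => v /span_colsP[w w0 ->]; rewrite -mulmxE -mulmxA tdiag_natcol.
  apply/span_colsP; eexists; last reflexivity.
  by move=> a /w0 /= ->; rewrite mulr0 if_same.
move=> c0; apply/eqP; rewrite eqEsubv sub_span /=.
suff {1}-> : A = A * tdiag n i c * tdiag n i c^-1 by apply: sub_span.
apply: eq_mulmx_natcol => u; rewrite -!mulmxE -!mulmxA !tdiag_natcol.
by congr (_ *m _); apply: eq_natcol => a _; case: eqP => _; rewrite ?mulVKf.
Qed.

Lemma span_cols_mul_prod_tdiag m A (s : seq nat) (f : nat -> nat) (c : F) : c != 0 ->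
  span_cols m (A * \prod_(a <- s) tdiag n (f a) c) = span_cols m A.
Proof.
move=> c0; elim: s A => [|a s IH] A; first by rewrite big_nil mulr1.
by rewrite big_cons mulrA IH span_cols_mul_tdiag.
Qed.

End OrthogonalComplement.

Section DMap.

Variables (F : fieldType) (n k : nat).
Hypothesis k_bounds : (1 <= k < n)%N.
Implicit Types x : rpoint n k F.

Let r := (n - k)%N.
Let r_bounds : (1 <= r < n)%N. Proof. by rewrite /r; lia. Qed.

(* An array of factors whose product along the rows i is the dual of Phi(x), and along the
   columns a is Phi(perp_map x), up to diagonal factors on the right. *)
Definition perp_factor x i a : 'M[F]_n :=
  xminus n (k - i + a) (ext_entry x i (i + r - a)).

Definition perp_Phi x : 'M[F]_n :=
  \prod_(i <- rev (index_iota 1 k.+1)) \prod_(a <- rev (index_iota 1 r.+1))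
    perp_factor x i a.

Lemma perp_factor_rows x i : (1 <= i <= k)%N ->
  \prod_(i <= l < i + r) xminus n (n - l) (ext_entry x i l)
  = \prod_(a <- rev (index_iota 1 r.+1)) perp_factor x i a.
Proof.
move=> i_bounds; rewrite -(add1n r) (big_rev_nat _ _ 1 i).
apply: eq_big_nat => l l_bounds; rewrite /perp_factor /r in l_bounds *.
by congr (xminus n _ (ext_entry x i _)); lia.
Qed.

Lemma altdual_Phi x : in_torus x -> altdual (Phi x)
  (perp_Phi x * \prod_(i <- rev (index_iota 1 k.+1)) tdiag n (n.+1 - (i + r)) x.2^-1).
Proof.
move=> x_torus; rewrite PhiE // /perp_Phi big_seq.
under [X in _ * X]eq_bigr => i _ do rewrite -(ext_entry_last x i).
rewrite -prod_mul_split ?pairwise_gtn_rev_iota // => [|i i' is1 i's lt_i'i]; last first.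
  rewrite big_seq; apply: commr_prod => a as_; apply: tdiag_xminus_comm;
    move: is1 i's as_; rewrite !mem_rev !mem_index_iota /r; lia.
rewrite -big_seq; apply: altdual_prod => i; rewrite mem_rev mem_index_iota => i_bounds.
rewrite -perp_factor_rows //; apply: altdual_Mint; try by rewrite /r; lia.
by move=> l l_bounds; apply: ext_entry_neq0.
Qed.

Definition perp_map x : rpoint n r F :=
  ([ffun p => entry x (k + fst_R p - snd_R p) (n - snd_R p)], x.2).

Lemma entry_perp_map x a b : in_R n r a b ->
  entry (perp_map x) a b = entry x (k + a - b) (n - b).
Proof. by case/(in_R_ex r_bounds) => p <- <-; rewrite entry_Rset ffunE. Qed.

Lemma perp_map_torus x : in_torus x -> in_torus (perp_map x).
Proof.
move=> x_torus [p|] /=; last exact: (x_torus None).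
by rewrite ffunE entry_neq0 //; have := in_R_Rset p; rewrite /in_R /r; lia.
Qed.

Lemma perp_factor_cols x a : (1 <= a <= r)%N ->
  \prod_(a <= b < a + k) xminus n b (ext_entry (perp_map x) a b)
  = \prod_(i <- rev (index_iota 1 k.+1)) perp_factor x i a.
Proof.
move=> a_bounds; rewrite -(add1n k) (big_rev_nat _ _ 1 a).
apply: eq_big_nat => b b_bounds; rewrite /perp_factor !ext_entryE; try by rewrite /r; lia.
rewrite entry_perp_map; last by rewrite /in_R /r; lia.
have -> : (1 + a + k - b.+1 = k + a - b)%N by lia.
have -> : (k - (k + a - b) + a = b)%N by lia.
by have -> : (k + a - b + r - a = n - b)%N by [rewrite /r; lia].
Qed.

Lemma Phi_perp_map x : Phi (perp_map x)
  = perp_Phi x * \prod_(a <- rev (index_iota 1 r.+1)) tdiag n (a + k) x.2.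
Proof.
have nr : (n - r = k)%N by rewrite /r; lia.
rewrite PhiE // nr /perp_Phi prod_exchange ?pairwise_gtn_rev_iota //; last first.
  move=> i i' a a'; rewrite !mem_rev !mem_index_iota => i_s i'_s a_s a'_s lt_i'i lt_a'a.
  by apply/commr_sym/xminus_comm; rewrite /r; lia.
rewrite -prod_mul_split ?pairwise_gtn_rev_iota // => [|a a' a_s a'_s lt_a'a]; last first.
  rewrite big_seq; apply: commr_prod => i i_s; apply: tdiag_xminus_comm;
    move: i_s a_s a'_s; rewrite !mem_rev !mem_index_iota /r; lia.
apply: eq_big_seq => a; rewrite mem_rev mem_index_iota => a_bounds.
rewrite -perp_factor_cols // /Mint -mulmxE.
by have -> : ext_entry (perp_map x) a (a + k) = x.2 by rewrite /ext_entry nr eqxx.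
Qed.

Lemma Tw0_perp_Theta x : in_torus x -> Tw0 (perp (Theta x).1) = (Theta (perp_map x)).1.
Proof.
move=> x_torus; rewrite (Tw0_perp_span_cols _ (altdual_Phi x_torus)).
rewrite /Theta /= Phi_perp_map.
by rewrite !span_cols_mul_prod_tdiag ?invr_eq0 ?(x_torus None).
Qed.

Definition refl_map : rpoint n k F -> rpoint n r F :=
  complement_map r (fun i j => j - i + 1)%N (fun _ j => j) (F := F).

Lemma in_R_refl i j : in_R n r i j -> in_R n k (j - i + 1) j.
Proof. by rewrite /in_R /r; lia. Qed.

Lemma rot_perp_map x : rot_map (perp_map x) = refl_map x.
Proof.
apply: coord_at_inj => -[p|] //=; have p_R := in_R_Rset p; rewrite !ffunE.
rewrite entry_perp_map; last by move: p_R; rewrite /in_R /r; lia.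
by congr (_ / entry x _ _); move: p_R; rewrite /in_R /r; lia.
Qed.

Lemma D_conj_graphE x (y : rpoint n r F) :
  in_torus x -> in_torus y -> D_conj_graph x y <-> y = refl_map x.
Proof.
move=> x_torus y_torus; have z_torus := perp_map_torus x_torus.
rewrite /D_conj_graph /D_graph Tw0_perp_Theta // -rot_perp_map.
have graphE := S_conj_graphE r_bounds z_torus y_torus.
split=> [[_ /graphE //]|/graphE Szy]; split=> //; exact: Theta_in_grass.
Qed.

End DMap.

Theorem theorem7p10 (R : realType) (n k : nat)
    (hn : (2 <= n)%N) (hk1 : (1 <= k)%N) (hk2 : (k <= n - 1)%N) :
  ((exists phi : rpoint n k (ratfun R[i] n k),
      rational_map_of phi (@S_conj_graph R[i] n k))
   /\ (forall phi : rpoint n k (ratfun R[i] n k),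
         rational_map_of phi (@S_conj_graph R[i] n k) ->
         (forall v, subtraction_free (coord_at phi v))
         /\ (forall Shat : rpoint n k int -> rpoint n k int,
               is_tropicalization phi Shat ->
               forall b : rpoint n k int, k_rectangle b -> Shat b = rot_tilde b)))
  /\
  ((exists psi : rpoint n (n - k) (ratfun R[i] n k),
      rational_map_of psi (@D_conj_graph R[i] n k))
   /\ (forall psi : rpoint n (n - k) (ratfun R[i] n k),
         rational_map_of psi (@D_conj_graph R[i] n k) ->
         (forall v, subtraction_free (coord_at psi v))
         /\ (forall Dhat : rpoint n k int -> rpoint n (n - k) int,
               is_tropicalization psi Dhat ->
               forall b : rpoint n k int, k_rectangle b -> Dhat b = refl_tilde b))).
Proof.
have k_bounds : (1 <= k < n)%N by lia.
have [S_ex S_trop] := complement_map_tropicalizes k_bounds (in_R_rot k_bounds)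
  (@S_conj_graphE R[i] n k k_bounds).
have [D_ex D_trop] := complement_map_tropicalizes k_bounds (@in_R_refl n k k_bounds)
  (@D_conj_graphE R[i] n k k_bounds).
split; split; [exact: S_ex | | exact: D_ex |].
- by move=> phi /S_trop[sf trop]; split=> // Shat /trop ShatE b _; exact: ShatE.
- by move=> psi /D_trop[sf trop]; split=> // Dhat /trop DhatE b _; exact: DhatE.
Qed.
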